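(* Let $F$ be a real quadratic field and let $p$ be a rational prime unramified in $F$. Let $U=U_0(\mathfrak n p^s)$ be a sufficiently small level, let $h=\dim S_2^D(U)$, and let $(\kappa,r)=(\kappa_\psi,r)$ be any locally algebraic weight. Then the Newton polygon of the normalized operator $U_p^0$ acting on the space $S^{D,\dagger}_{\kappa,r}(U)$ of overconvergent forms of level $U$ and weight $(\kappa,r)$ lies on or above the polygon with vertices $$(0,0),\ (h,0),\ (3h,2h),\ \dots,\ \left(\frac{i(i+1)h}{2},\ \frac{(i-1)i(i+1)h}{3}\right),\ \dots$$
   Context: **Setting.** $F$ is a real quadratic field, $g=[F:\mathbb Q]=2$, $\mathcal O_F$ its ring of integers, $p$ a rational prime unramified in $F$, $\mathcal O_p=\mathcal O_F\otimes\mathbb Z_p=\prod_{\mathfrak p\mid p}\mathcal O_{\mathfrak p}$, with fixed uniformisers $\pi_{\mathfrak p}$. $D$ is the totally definite quaternion algebra over $F$ unramified at all finite places, $\mathcal O_D$ a fixed maximal order, $D_f^\times=(D\otimes_{\mathbb Q}\mathbb A_f)^\times$, with fixed splittings $\mathcal O_D\otimes_{\mathcal O_F}\mathcal O_{\mathfrak q}\cong M_2(\mathcal O_{\mathfrak q})$ at the primes $\mathfrak q$ dividing $\mathfrak n p$; for $u\in D_f^\times$, $u_p$ denotes the component in $\mathrm{GL}_2(F\otimes\mathbb Q_p)$. **Levels.** $\mathfrak n$ is an ideal of $\mathcal O_F$ prime to $p$, $s\ge1$ an integer, and $U_0(\mathfrak n p^s)=\{\gamma\in(\mathcal O_D\otimes\widehat{\mathbb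 Z})^\times:\gamma\equiv\left(\begin{smallmatrix}*&*\\0&*\end{smallmatrix}\right)\bmod \mathfrak n p^s\}$. Write $D_f^\times=\coprod_i D^\times t_iU$ (a finite disjoint union) and $\Gamma^i(U)=D^\times\cap t_iUt_i^{-1}$. $U$ is *sufficiently small* if $\Gamma^i(U)/(F^\times\cap\Gamma^i(U))$ is trivial for all $i$. **Weights.** Let $L$ be a complete extension of $\mathbb Q_p$ (inside $\mathbb C_p$) containing the images of all embeddings $\sigma_1,\dots,\sigma_g:F\to\overline{\mathbb Q}_p$ (these are identified with the infinite places of $F$ through a fixed isomorphism $\mathbb C\cong\overline{\mathbb Q}_p$) and the values of $\psi$. A locally algebraic weight $(\kappa,r)=(\kappa_\psi,r)$ is given by $n,v\in\mathbb Z^g$ and $r\in\mathbb Z$ with $n+2v=(r,\dots,r)$ (algebraic part $(k,r)$, $k=n+2$), together with a finite order character $\psi:\mathcal O_p^\times\to L^\times$ factoring through $(\mathcal O_p/p^s)^\times$. It is assumed that $\psi(x)=N_{F/\mathbb Q}(x)^r$ for all $x\in\mathcal O_F^\times$. **Overconvergent forms.** Let $\Delta_s$ be the monoid of $\gamma=\left(\begin{smallmatrix}a&b\\c&d\end{smallmatrix}\right)\in M_2(\mathcal O_p)$ such that at each $\mathfrak p\mid p$ the determinant is nonzero, $\pi_{\mathfrak p}^s\mid c$ and $\pi_{\mathfrak p}\nmid d$. Let $a_i,b_i,c_i,d_i$ be the images of $a,b,c,d$ under $\sigma_i:\mathcal O_p\to L$ and $\gamma_i=\left(\begin{smallmatrix}a_i&b_i\\c_i&d_i\end{smallmatrix}\right)$.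 Let $L\langle\underline X\rangle=L\langle X_1,\dots,X_g\rangle$ be the Tate algebra (power series with coefficients tending to $0$). $\Delta_s$ acts on the right by $$\prod_iX_i^{l_i}\cdot\gamma=\psi(d)\prod_{i=1}^g\det(\gamma_i)^{v_i}(c_iX_i+d_i)^{n_i}\left(\frac{a_iX_i+b_i}{c_iX_i+d_i}\right)^{l_i}.$$ $S^{D,\dagger}_{\kappa,r}(U)$ is the $L$-vector space of functions $f:D^\times\backslash D_f^\times\to L\langle\underline X\rangle$ with $f(gu^{-1})\cdot u_p=f(g)$ for all $u\in U$, $g\in D_f^\times$. If $h'$ is the number of double cosets $D^\times\backslash D_f^\times/U$, then $f\mapsto(f(t_i))_i$ identifies it with $\bigoplus_{i=1}^{h'}L\langle\underline X\rangle$ for $U$ sufficiently small. $S_2^D(U)$ is the space of weight $[2,2]$ forms, i.e. of functions $D^\times\backslash D_f^\times/U\to L$ (including those factoring through the reduced norm). **Hecke operators.** For $\mathfrak p\mid p$, $U_{\mathfrak p}$ is the operator $$(f|U_{\mathfrak p})(g)=\sum_{\alpha\in\mathcal O_{\mathfrak p}/\pi_{\mathfrak p}}f(gu_\alpha^{-1})\cdot(u_\alpha)_p,$$ where $u_\alpha\in D_f^\times$ is $\left(\begin{smallmatrix}\pi_{\mathfrak p}&0\\\alpha\pi_{\mathfrak p}^s&1\end{smallmatrix}\right)$ at $\mathfrak p$ and $1$ elsewhere. Put $U_p=\prod_{\mathfrak p\mid p}U_{\mathfrak p}$ (a compact operator) and $U_p^0=\prod_{\mathfrak p\mid p}\pi_{\mathfrak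 p}^{-v_{\mathfrak p}(\kappa)}U_p$, where $v_{\mathfrak p}(\kappa)=\sum v_i$ over those $i$ for which $\sigma_i$ induces the place $\mathfrak p$, and $\pi_{\mathfrak p}$ is viewed in $L$ through any such $\sigma_i$ (the choice does not affect Newton polygons). The Newton polygon of a compact operator $V$ is that of the Fredholm series $\det(1-XV)=\sum_m c_mX^m$, i.e. the lower convex hull of the points $(m,\mathrm{val}_p(c_m))$, with $\mathrm{val}_p(p)=1$. *)

(* Defs.v *)
From HB Require Import structures.
From mathcomp Require Import all_boot all_order all_algebra all_field.
From mathcomp Require Import finmap.
From mathcomp Require Import all_classical all_reals ereal.
From mathcomp Require Import ring.

Set Implicit Arguments.
Unset Strict Implicit.
Unset Printing Implicit Defensive.

Import Order.TTheory GRing.Theory Num.Theory.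

Local Open Scope classical_set_scope.
Local Open Scope ring_scope.

(* Additive (exponential) valuations with values in R, and +oo at 0. *)
Record is_valuation (R : realType) (K : fieldType) (v : K -> \bar R) : Prop := {
  valuation_eqy : forall x, v x = +oo%E <-> x = 0;
  valuation_neqNy : forall x, v x != -oo%E;
  valuationM : forall x y, v (x * y) = (v x + v y)%E;
  valuationD : forall x y, (Order.min (v x) (v y) <= v (x + y)%R)%E }.

Definition is_complete (R : realType) (K : fieldType) (v : K -> \bar R) : Prop :=
  forall u : nat -> K,
    (forall A : R, exists N, forall m n,
       (N <= m)%N -> (N <= n)%N -> (A%:E <= v (u m - u n)%R)%E) ->
    exists l : K, forall A : R, exists N, forall n,
       (N <= n)%N -> (A%:E <= v (u n - l)%R)%E.

(* C_p, up to isometric isomorphism: an algebraically closed field, complete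
   for a valuation with value 1 at p, in which the algebraic numbers are
   dense. *)
Record padic_complex (R : realType) (p : nat) := PadicComplex {
  Cp_sort :> closedFieldType;
  Cp_val : Cp_sort -> \bar R;
  Cp_valuation : is_valuation Cp_val;
  Cp_val_p : Cp_val p%:R = 1%:E;
  Cp_complete : is_complete Cp_val;
  Cp_dense : forall (x : Cp_sort) (A : R), exists y : Cp_sort,
    algebraicOver (ratr : rat -> Cp_sort) y /\ (A%:E <= Cp_val (x - y)%R)%E }.

(* Limit of a net indexed by the finite subsets of I, and unconditional sums;
   [vsum] is 0 when the family is not summable. *)
Section Sums.
Variables (R : realType) (L : fieldType) (v : L -> \bar R) (I : choiceType).

Definition fset_lim (F : {fset I} -> L) (l : L) : Prop :=
  forall A : R, exists K0 : {fset I}, forall K : {fset I},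
    (K0 `<=` K)%fset -> (A%:E <= v (F K - l)%R)%E.

Definition is_vsum (a : I -> L) (l : L) : Prop :=
  fset_lim (fun K : {fset I} => \sum_(i <- K) a i) l.

Definition vsum (a : I -> L) : L := xget 0 [set l | is_vsum a l].

End Sums.

(* The quaternion algebra (a, b / K): basis 1, i, j, k = ij with i^2 = a,
   j^2 = b, ji = - ij. *)
Record quat (K : fieldType) (a b : K) :=
  Quat { q0 : K; q1 : K; q2 : K; q3 : K }.
Arguments Quat {K a b}.

Section Quaternion.
Variables (K : fieldType) (a b : K).
Local Notation quat := (quat a b).
Implicit Types (x y : quat) (c d : K).

Definition quat_tuple (x : quat) : K * K * K * K := (q0 x, q1 x, q2 x, q3 x).
Definition tuple_quat (t : K * K * K * K) : quat :=
  Quat t.1.1.1 t.1.1.2 t.1.2 t.2.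
Lemma quat_tupleK : cancel quat_tuple tuple_quat. Proof. by case. Qed.

HB.instance Definition _ := Equality.copy quat (can_type quat_tupleK).
HB.instance Definition _ := Choice.copy quat (can_type quat_tupleK).

Definition quat_zero : quat := Quat 0 0 0 0.
Definition quat_const c : quat := Quat c 0 0 0.
Definition quat_opp x : quat := Quat (- q0 x) (- q1 x) (- q2 x) (- q3 x).
Definition quat_add x y : quat :=
  Quat (q0 x + q0 y) (q1 x + q1 y) (q2 x + q2 y) (q3 x + q3 y).
Definition quat_one : quat := Quat 1 0 0 0.
Definition quat_mul x y : quat := Quat
  (q0 x * q0 y + a * (q1 x * q1 y) + b * (q2 x * q2 y) - a * b * (q3 x * q3 y))
  (q0 x * q1 y + q1 x * q0 y - b * (q2 x * q3 y) + b * (q3 x * q2 y))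
  (q0 x * q2 y + q2 x * q0 y + a * (q1 x * q3 y) - a * (q3 x * q1 y))
  (q0 x * q3 y + q3 x * q0 y + q1 x * q2 y - q2 x * q1 y).
Definition quat_scale c x : quat := Quat (c * q0 x) (c * q1 x) (c * q2 x) (c * q3 x).
Definition quat_conj x : quat := Quat (q0 x) (- q1 x) (- q2 x) (- q3 x).
Definition quat_nrd x :=
  q0 x ^+ 2 - a * q1 x ^+ 2 - b * q2 x ^+ 2 + a * b * q3 x ^+ 2.

Fact quat_addA : associative quat_add.
Proof. by move=> [? ? ? ?] [? ? ? ?] [? ? ? ?]; rewrite /quat_add /= !addrA. Qed.
Fact quat_addC : commutative quat_add.
Proof.
by move=> [x0 x1 x2 x3] [? ? ? ?]; rewrite /quat_add /= (addrC x0) (addrC x1)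
  (addrC x2) (addrC x3).
Qed.
Fact quat_add0 : left_id quat_zero quat_add.
Proof. by move=> [? ? ? ?]; rewrite /quat_add /= !add0r. Qed.
Fact quat_addN : left_inverse quat_zero quat_opp quat_add.
Proof. by move=> [? ? ? ?]; rewrite /quat_add /= !addNr. Qed.

HB.instance Definition _ :=
  GRing.isZmodule.Build quat quat_addA quat_addC quat_add0 quat_addN.

Fact quat_mulA : associative quat_mul.
Proof.
by move=> [? ? ? ?] [? ? ? ?] [? ? ? ?]; rewrite /quat_mul /=; congr Quat; ring.
Qed.
Fact quat_mul1l : left_id quat_one quat_mul.
Proof. by move=> [? ? ? ?]; rewrite /quat_mul /=; congr Quat; ring. Qed.
Fact quat_mul1r : right_id quat_one quat_mul.
Proof. by move=> [? ? ? ?]; rewrite /quat_mul /=; congr Quat; ring. Qed.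
Fact quat_mulDl : left_distributive quat_mul quat_add.
Proof.
by move=> [? ? ? ?] [? ? ? ?] [? ? ? ?]; rewrite /quat_mul /quat_add /=;
  congr Quat; ring.
Qed.
Fact quat_mulDr : right_distributive quat_mul quat_add.
Proof.
by move=> [? ? ? ?] [? ? ? ?] [? ? ? ?]; rewrite /quat_mul /quat_add /=;
  congr Quat; ring.
Qed.
Fact quat_one_neq0 : quat_one != 0.
Proof. by apply/eqP => -[/eqP]; rewrite oner_eq0. Qed.

HB.instance Definition _ := GRing.Zmodule_isNzRing.Build quat
  quat_mulA quat_mul1l quat_mul1r quat_mulDl quat_mulDr quat_one_neq0.

Fact quat_scaleA c d x : quat_scale c (quat_scale d x) = quat_scale (c * d) x.
Proof. by rewrite /quat_scale /= !mulrA. Qed.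
Fact quat_scale1 : left_id 1 quat_scale.
Proof. by move=> [? ? ? ?]; rewrite /quat_scale /= !mul1r. Qed.
Fact quat_scaleDr : right_distributive quat_scale +%R.
Proof. by move=> c [? ? ? ?] [? ? ? ?]; rewrite /quat_scale /= !mulrDr. Qed.
Fact quat_scaleDl x : {morph quat_scale^~ x : c d / c + d}.
Proof. by case: x => ? ? ? ? c d; rewrite /quat_scale /= !mulrDl. Qed.

HB.instance Definition _ := GRing.Zmodule_isLmodule.Build K quat
  quat_scaleA quat_scale1 quat_scaleDr quat_scaleDl.

Definition quat_unit : pred quat := [pred x | quat_nrd x != 0].
Definition quat_inv (x : quat) : quat :=
  if quat_unit x then quat_scale (quat_nrd x)^-1 (quat_conj x) else x.

Fact quat_mulV : {in quat_unit, left_inverse 1 quat_inv *%R}.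
Proof.
move=> x xu; rewrite /quat_inv; have -> : quat_unit x by [].
rewrite -[LHS]/(quat_mul _ _) -[RHS]/quat_one.
move: xu; rewrite inE /quat_unit /quat_nrd /=.
by case: x => x0 x1 x2 x3 /= xu; rewrite /quat_mul /quat_one /=; congr Quat; field.
Qed.
Fact quat_divV : {in quat_unit, right_inverse 1 quat_inv *%R}.
Proof.
move=> x xu; rewrite /quat_inv; have -> : quat_unit x by [].
rewrite -[LHS]/(quat_mul _ _) -[RHS]/quat_one.
move: xu; rewrite inE /quat_unit /quat_nrd /=.
by case: x => x0 x1 x2 x3 /= xu; rewrite /quat_mul /quat_one /=; congr Quat; field.
Qed.
Fact quat_unitP x y : y * x = 1 /\ x * y = 1 -> quat_unit x.
Proof.
case=> _ xy1; rewrite /quat_unit /=; apply/eqP => x0.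
have : quat_nrd (x * y) = quat_nrd x * quat_nrd y.
  rewrite -[x * y]/(quat_mul x y) /quat_mul /quat_nrd /=; ring.
rewrite x0 mul0r xy1 /quat_nrd /= expr1n expr0n /= !mulr0 !subr0 addr0.
by move/eqP; rewrite oner_eq0.
Qed.
Fact quat_inv_out : {in [predC quat_unit], quat_inv =1 id}.
Proof.
move=> x nx; rewrite /quat_inv; case: ifP => // ux.
by move: nx; rewrite inE /= [x \in _]ux.
Qed.

HB.instance Definition _ := GRing.NzRing_hasMulInverse.Build quat
  quat_mulV quat_divV quat_unitP quat_inv_out.

End Quaternion.

Section QuaternionMap.
Variables (K K' : fieldType) (f : {rmorphism K -> K'}) (a b : K).

Definition quat_map (x : quat a b) : quat (f a) (f b) :=
  Quat (f (q0 x)) (f (q1 x)) (f (q2 x)) (f (q3 x)).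

Lemma quat_mapM : {morph quat_map : x y / x * y}.
Proof.
move=> x y; rewrite -[x * y]/(quat_mul x y) -[RHS]/(quat_mul _ _).
by rewrite /quat_map /quat_mul /= !(rmorphB, rmorphD, rmorphM).
Qed.

Lemma quat_map1 : quat_map 1 = 1.
Proof. by rewrite /quat_map /= rmorph1 !rmorph0. Qed.

End QuaternionMap.

Section NumberField.
Variable F : fieldExtType rat.

Definition real_quadratic (R : realType) : Prop :=
  \dim {:F} = 2%N /\ inhabited {rmorphism F -> R}.

Definition ringOfInt : set F := [set x | integralOver (intr : int -> F) x].

Definition unitOfInt : set F := [set x | [/\ x != 0, ringOfInt x & ringOfInt x^-1]].

Definition is_ideal (I : set F) : Prop :=
  [/\ I `<=` ringOfInt, I 0, (forall x y, I x -> I y -> I (x + y)) &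
      (forall x y, ringOfInt x -> I y -> I (x * y))].

Definition is_prime_ideal (q : set F) : Prop :=
  [/\ is_ideal q, ~ q 1 & forall x y,
      ringOfInt x -> ringOfInt y -> q (x * y) -> q x \/ q y].

(* The finite places of F are the nonzero prime ideals of its ring of
   integers. *)
Record place := Place {
  place_ideal :> set F;
  place_prime : is_prime_ideal place_ideal;
  place_neq0 : exists2 x, place_ideal x & x != 0 }.

HB.instance Definition _ := gen_eqMixin place.
HB.instance Definition _ := gen_choiceMixin place.

Definition divides (q : place) (I : set F) : Prop := I `<=` q.

Definition pplace (p : nat) := {q : place | `[< place_ideal q p%:R >]}.
Coercion place_of (p : nat) (q : pplace p) : place := val q.

Definition prime_to (n : set F) (p : nat) : Prop :=
  exists x y, [/\ n x, ringOfInt y & x + p%:R * y = 1].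

(* A completion of F at q, with its valuation normalised to have value group
   Z. The last two fields say that O_F has centre q, which forces the
   valuation to extend the q-adic one. *)
Record completion (R : realType) (q : place) := Completion {
  cfield :> fieldType;
  cval : cfield -> \bar R;
  cmap : {rmorphism F -> cfield};
  cval_valuation : is_valuation cval;
  cval_complete : is_complete cval;
  cmap_dense : forall (x : cfield) (A : R),
    exists y : F, (A%:E <= cval (x - cmap y)%R)%E;
  cval_int : forall x : cfield, x != 0 -> exists n : int, cval x = (n%:~R)%:E;
  cval_onto : exists x : cfield, cval x = 1%:E;
  cval_ge0 : forall x, ringOfInt x -> (0 <= cval (cmap x))%E;
  cval_gt0 : forall x, ringOfInt x -> (place_ideal q x <-> (0 < cval (cmap x))%E) }.

Definition cint (R : realType) (q : place) (Fq : completion R q) : set Fq :=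
  [set x | (0 <= cval x)%E].

(* The ramification index e(q|p) is the normalised valuation of p. *)
Definition unramified (R : realType) (Fv : forall q : place, completion R q)
    (p : nat) : Prop :=
  forall q : pplace p, cval (p%:R : Fv q) = 1%:E.

(* The ideal of O_q generated by an ideal I of O_F. *)
Definition local_ideal (R : realType) (q : place) (Fq : completion R q)
    (I : set F) : set Fq :=
  [set x | exists2 s : seq (Fq * F),
     (forall k, k \in s -> cint k.1 /\ I k.2) &
     x = \sum_(k <- s) k.1 * cmap Fq k.2].

End NumberField.

Section QuaternionOverNumberField.
Variables (F : fieldExtType rat) (a b : F).

Definition totally_definite (R : realType) : Prop :=
  forall tau : {rmorphism F -> R},
  forall x : quat (tau a) (tau b), x != 0 -> x \is a GRing.unit.

Definition is_order (O : set (quat a b)) : Prop :=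
  [/\ [/\ O 1, (forall x y, O x -> O y -> O (x - y)) &
          (forall x y, O x -> O y -> O (x * y))],
      (forall c, ringOfInt c -> O (quat_const a b c)),
      (exists (n : nat) (e : 'I_n -> quat a b), (forall k, O (e k)) /\
         forall x, O x -> exists2 c : 'I_n -> F,
           (forall k, ringOfInt (c k)) & x = \sum_k c k *: e k) &
      (forall x, exists c, [/\ ringOfInt c, c != 0 & O (c *: x)])].

Record max_order := MaxOrder {
  order_set :> set (quat a b);
  order_order : is_order order_set;
  order_maximal : forall O, is_order O -> order_set `<=` O -> O = order_set }.

Variables (R : realType) (Fv : forall q : place F, completion R q).

(* D (x)_F F_q *)
Definition Dloc (q : place F) := quat (cmap (Fv q) a) (cmap (Fv q) b).

Definition Dmap (q : place F) (d : quat a b) : Dloc q := quat_map (cmap (Fv q)) d.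

Definition unramified_at (q : place F) : Prop :=
  exists theta : {rmorphism Dloc q -> 'M[Fv q]_2},
    bijective theta /\ (forall c x, theta (c *: x) = c *: theta x).

Variable OD : max_order.

(* O_D (x)_{O_F} O_q *)
Definition Oloc (q : place F) : set (Dloc q) :=
  [set x | exists2 s : seq (Fv q * quat a b),
     (forall k, k \in s -> cint k.1 /\ order_set OD k.2) &
     x = \sum_(k <- s) k.1 *: Dmap q k.2].

Definition is_splitting (q : place F)
    (theta : {rmorphism Dloc q -> 'M[Fv q]_2}) : Prop :=
  [/\ bijective theta, (forall c x, theta (c *: x) = c *: theta x) &
      forall x, Oloc x <-> forall i j, cint (theta x i j)].

(* D_f^x: the unit group of the restricted product of the D (x)_F F_q with
   respect to the O_D (x) O_q. *)
Definition is_Dfx (g : forall q, Dloc q) : Prop :=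
  [/\ forall q, g q \is a GRing.unit, finite_set [set q | ~ Oloc (g q)] &
      finite_set [set q | ~ Oloc (g q)^-1]].

Record Dfx := MkDfx { dfx :> forall q, Dloc q; dfxP : is_Dfx dfx }.

Lemma dfx_inj (g h : Dfx) : (forall q, g q = h q) -> g = h.
Proof.
case: g h => [g gP] [h hP] /= gh.
have {}gh : g = h by apply: functional_extensionality_dep.
by case: _ / gh hP => hP; congr MkDfx; apply: Prop_irrelevance.
Qed.

Lemma Oloc1 q : Oloc (1 : Dloc q).
Proof.
exists [:: (1, 1)] => [k|]; last by rewrite big_seq1 scale1r /Dmap quat_map1.
rewrite inE => /eqP ->; split; last by have [[]] := order_order OD.
rewrite /cint /=; have := cval_ge0 (Fv q) (_ : ringOfInt 1).
by rewrite rmorph1; apply; apply: integral1.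
Qed.

Lemma cintM q (x y : Fv q) : cint x -> cint y -> cint (x * y).
Proof.
by rewrite /cint /= => x0 y0; rewrite (valuationM (cval_valuation (Fv q))) adde_ge0.
Qed.

Lemma OlocM q (x y : Dloc q) : Oloc x -> Oloc y -> Oloc (x * y).
Proof.
move=> [s sP ->] [t tP ->].
exists [seq (k.1 * l.1, k.2 * l.2) | k <- s, l <- t].
  move=> _ /allpairsP[[k l] /= [/sP[k1 k2] /tP[l1 l2] ->]] /=.
  by split; [exact: cintM | have [[_ _ OM] _ _ _] := order_order OD; exact: OM].
rewrite big_allpairs_dep mulr_suml; apply: eq_bigr => k _; rewrite mulr_sumr.
apply: eq_bigr => l _ /=.
rewrite /Dmap quat_mapM.
case: (quat_map _ k.2) => x0 x1 x2 x3; case: (quat_map _ l.2) => y0 y1 y2 y3.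
rewrite -[LHS]/(quat_mul (quat_scale _ _) (quat_scale _ _)).
rewrite -[RHS]/(quat_scale _ (quat_mul _ _)) /quat_scale /quat_mul /=.
by congr Quat; ring.
Qed.

Lemma is_Dfx1 : is_Dfx (fun q => 1).
Proof.
split=> [q||]; first exact: unitr1.
- by apply: (sub_finite_set _ (finite_set0 _)) => q /= []; exact: Oloc1.
- by apply: (sub_finite_set _ (finite_set0 _)) => q /= []; rewrite invr1; exact: Oloc1.
Qed.

Lemma is_DfxV (g : Dfx) : is_Dfx (fun q => (g q)^-1).
Proof.
case: (dfxP g) => gu gf gVf; split=> [q|//|]; first by rewrite unitrV; exact: gu.
by apply: (sub_finite_set _ gf) => q /=; rewrite invrK.
Qed.

Lemma is_DfxM (g h : Dfx) : is_Dfx (fun q => g q * h q).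
Proof.
case: (dfxP g) => gu gf gVf; case: (dfxP h) => hu hf hVf.
have fU (A B : set (place F)) : finite_set A -> finite_set B -> finite_set (A `|` B).
  by move=> fA fB; rewrite finite_setU.
split=> [q||]; first by rewrite unitrMr; [exact: hu | exact: gu].
- apply: (sub_finite_set _ (fU _ _ gf hf)) => q /= nO.
  by apply/not_andP => -[? ?]; apply: nO; exact: OlocM.
- apply: (sub_finite_set _ (fU _ _ gVf hVf)) => q /= nO.
  by apply/not_andP => -[? ?]; apply: nO; rewrite invrM; [exact: OlocM | exact: gu | exact: hu].
Qed.

Definition dfx_one := MkDfx is_Dfx1.
Definition dfx_inv (g : Dfx) := MkDfx (is_DfxV g).
Definition dfx_mul (g h : Dfx) := MkDfx (is_DfxM g h).

Fact dfx_mulA : associative dfx_mul.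
Proof. by move=> ? ? ?; apply: dfx_inj => q /=; rewrite mulrA. Qed.
Fact dfx_mul1l : left_id dfx_one dfx_mul.
Proof. by move=> ?; apply: dfx_inj => q /=; rewrite mul1r. Qed.
Fact dfx_mul1r : right_id dfx_one dfx_mul.
Proof. by move=> ?; apply: dfx_inj => q /=; rewrite mulr1. Qed.
Fact dfx_mulV : left_inverse dfx_one dfx_inv dfx_mul.
Proof. by move=> g; apply: dfx_inj => q /=; have [gu _ _] := dfxP g; exact: (mulVr (gu q)). Qed.
Fact dfx_divV : right_inverse dfx_one dfx_inv dfx_mul.
Proof. by move=> g; apply: dfx_inj => q /=; have [gu _ _] := dfxP g; exact: (divrr (gu q)). Qed.

HB.instance Definition _ := gen_eqMixin Dfx.
HB.instance Definition _ := gen_choiceMixin Dfx.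
HB.instance Definition _ :=
  isGroup.Build Dfx dfx_mulA dfx_mul1l dfx_mul1r dfx_mulV dfx_divV.

(* [rat_mul d g g'] : g' = d g, for d in D^x embedded diagonally. *)
Definition rat_mul (d : quat a b) (g g' : Dfx) : Prop :=
  d \is a GRing.unit /\ forall q, g' q = Dmap q d * g q.

(* g lies in the double coset D^x t U. *)
Definition in_double_coset (U : set Dfx) (t g : Dfx) : Prop :=
  exists d u, U u /\ rat_mul d (t * u)%g g.

(* The disjoint union of the D^x t_i U is D_f^x. *)
Definition double_coset_reps (U : set Dfx) (h : nat) (t : 'I_h -> Dfx) : Prop :=
  (forall g, exists i, in_double_coset U (t i) g) /\
  (forall i j g, in_double_coset U (t i) g -> in_double_coset U (t j) g -> i = j).

(* D^x cap t U t^-1 *)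
Definition Gamma (U : set Dfx) (t : Dfx) : set (quat a b) :=
  [set d | d \is a GRing.unit /\
     exists2 u, U u & forall q, Dmap q d = (t * u * t^-1)%g q].

Definition sufficiently_small (U : set Dfx) (h : nat) (t : 'I_h -> Dfx) : Prop :=
  forall i d, Gamma U (t i) d -> exists c : F, d = quat_const a b c.

Definition left_invariant (T : Type) (f : Dfx -> T) : Prop :=
  forall d g g', rat_mul d g g' -> f g' = f g.

(* U_0(n p^s); theta is only used at the primes dividing n p. *)
Definition U0 (theta : forall q, {rmorphism Dloc q -> 'M[Fv q]_2})
    (n : set F) (p s : nat) : set Dfx :=
  [set u | forall q, [/\ Oloc (u q), Oloc (u q)^-1 &
     divides q [set p%:R * x | x in n] ->
     local_ideal [set p%:R ^+ s * x | x in n] (theta q (u q) ord_max ord0)]].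

Definition S2 (L : fieldType) (U : set Dfx) : set (Dfx -> L^o) :=
  [set f | left_invariant f /\ forall g u, U u -> f (g * u)%g = f g].

End QuaternionOverNumberField.

Definition has_dim (L : fieldType) (V : lmodType L) (S : set V) (h : nat) : Prop :=
  exists e : 'I_h -> V, (forall k, S (e k)) /\
    forall f, S f -> exists! c : 'I_h -> L, f = \sum_k c k *: e k.

(* Formal power series in one variable over L, as coefficient sequences. *)
Section Series.
Variable L : fieldType.
Implicit Types (f g : nat -> L) (a b c d : L).

Definition ser_one : nat -> L := fun k => (k == 0)%:R.

Definition ser_mul f g : nat -> L := fun k => \sum_(j < k.+1) f j * g (k - j)%N.

Definition ser_exp f (m : nat) : nat -> L := iter m (ser_mul f) ser_one.

(* a X + b *)
Definition lin a b : nat -> L :=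
  fun k => if k is 0 then b else if k is 1 then a else 0.

(* (c X + d)^-1, for d != 0 *)
Definition lin_inv c d : nat -> L := fun k => (- c) ^+ k / d ^+ k.+1.

(* (c X + d)^z *)
Definition lin_expz c d (z : int) : nat -> L :=
  match z with
  | Posz m => ser_exp (lin c d) m
  | Negz m => ser_exp (lin_inv c d) m.+1
  end.

End Series.

Definition multi := {ffun 'I_2 -> nat}.

(* L<X_1, X_2>, inside the power series [multi -> L]. *)
Definition tate (R : realType) (L : fieldType) (v : L -> \bar R) : set (multi -> L) :=
  [set f | forall A : R, finite_set [set m | ~ (A%:E <= v (f m))%E]].

Definition mx2 (K : nzRingType) (a b c d : K) : 'M[K]_2 :=
  \matrix_(i, j) if i == ord0 then (if j == ord0 then a else b)
                 else (if j == ord0 then c else d).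

Section LocalWeights.
Variables (R : realType) (F : fieldExtType rat) (p : nat).
Variable Fv : forall q : place F, completion R q.

(* F (x) Q_p, as the product of the F_q over the places q above p. *)
Definition Fp := forall q : pplace F p, Fv q.

Definition Fp_diag (x : F) : Fp := fun q => cmap (Fv q) x.

Definition Op_unit (x : Fp) : Prop := forall q, cval (x q) = 0%E.

Definition Op_cong (s : nat) (x y : Fp) : Prop :=
  forall q : pplace F p, exists2 z : Fv q, cint z & x q - y q = p%:R ^+ s * z.

Variables (L : fieldType) (v : L -> \bar R).

(* sigma-hat is the continuous extension of sigma to F_q; such an extension
   exists exactly when q is the place induced by sigma. *)
Definition is_extension (q : place F) (sigma : {rmorphism F -> L})
    (sigma_hat : {rmorphism Fv q -> L}) : Prop :=
  (forall x, sigma_hat (cmap (Fv q) x) = sigma x) /\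
  (forall A : R, exists B : R, forall x : Fv q,
     (B%:E <= cval x)%E -> (A%:E <= v (sigma_hat x))%E).

(* Characters of O_p^x with values in L^x that factor through (O_p / p^s)^x;
   values outside O_p^x are irrelevant. *)
Definition is_character (s : nat) (psi : Fp -> L) : Prop :=
  [/\ forall x, Op_unit x -> psi x != 0,
      forall x y, Op_unit x -> Op_unit y ->
        psi (fun q => x q * y q) = psi x * psi y,
      forall x y, Op_unit x -> Op_unit y -> Op_cong s x y -> psi x = psi y &
      exists2 m, (0 < m)%N & forall x, Op_unit x -> psi x ^+ m = 1].

Variables (pl : 'I_2 -> pplace F p) (sigma : forall i, {rmorphism Fv (pl i) -> L}).
Variables (n w : 'I_2 -> int) (psi : Fp -> L).

(* The coefficient of X^m in (prod_i X_i^l_i) . gamma. *)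
Definition mono_act (gamma : forall q : pplace F p, 'M[Fv q]_2)
    (l m : multi) : L :=
  psi (fun q => gamma q ord_max ord_max) *
  \prod_i
    (let g := map_mx (sigma i) (gamma (pl i)) in
     let a := g ord0 ord0 in let b := g ord0 ord_max in
     let c := g ord_max ord0 in let d := g ord_max ord_max in
     (\det g) ^ (w i) *
     ser_mul (lin_expz c d (n i))
             (ser_exp (ser_mul (lin a b) (lin_inv c d)) (l i)) (m i)).

(* f . gamma, extended from monomials by linearity and continuity. This is only
   used on L<X_1, X_2> and for gamma in Delta_s: entries in O_q, c divisible by
   pi_q^s, d a unit and det gamma nonzero at every q above p. *)
Definition weight_act (f : multi -> L)
    (gamma : forall q : pplace F p, 'M[Fv q]_2) : multi -> L :=
  fun m => vsum v (fun l => f l * mono_act gamma l m).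

Variables (a b : F) (OD : max_order a b).
Variable theta : forall q, {rmorphism Dloc a b Fv q -> 'M[Fv q]_2}.

(* The component u_p, as matrices through the splittings. *)
Definition at_p (u : Dfx Fv OD) : forall q : pplace F p, 'M[Fv q]_2 :=
  fun q => theta q (u q).

Definition overconvergent (U : set (Dfx Fv OD)) : set (Dfx Fv OD -> multi -> L) :=
  [set f | [/\ forall g, tate v (f g), left_invariant f &
     forall g u, U u -> weight_act (f (g * u^-1)%g) (at_p u) = f g]].

Variables (s : nat) (pi : forall q : pplace F p, Fv q).

Definition hecke_elt (q : pplace F p) (alpha : Fv q) : Dfx Fv OD :=
  xget 1%g [set u : Dfx Fv OD | theta q (u q) =
                      mx2 (pi q) 0 (alpha * pi q ^+ s) 1 /\
                    forall q' : place F, q' <> q -> u q' = 1].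

(* A complete system of representatives of O_q / pi_q. *)
Definition residue_system (q : place F) (A : seq (Fv q)) : Prop :=
  [/\ uniq A, (forall x, x \in A -> cint x),
      (forall x y, x \in A -> y \in A -> (1 <= cval (x - y)%R)%E -> x = y) &
      (forall x, cint x -> exists2 y, y \in A & (1 <= cval (x - y)%R)%E)].

Variable A : forall q : pplace F p, seq (Fv q).

Definition hecke (q : pplace F p) (f : Dfx Fv OD -> multi -> L) :
    Dfx Fv OD -> multi -> L :=
  fun g m => \sum_(alpha <- A q)
    weight_act (f (g * (hecke_elt alpha)^-1)%g) (at_p (hecke_elt alpha)) m.

(* [ps] lists the places above p. *)
Variables (ps : seq (pplace F p)) (idx : pplace F p -> 'I_2).

Definition v_weight (q : pplace F p) : int := \sum_(i | pl i == q) w i.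

(* The image of pi_q in L under an embedding sigma_i inducing q, selected by
   idx: pl (idx q) = q, so pi (pl (idx q)) is pi_q. *)
Definition pi_in_L (q : pplace F p) : L := sigma (idx q) (pi (pl (idx q))).

Definition Up (f : Dfx Fv OD -> multi -> L) : Dfx Fv OD -> multi -> L :=
  foldr hecke f ps.

Definition Up0 (f : Dfx Fv OD -> multi -> L) : Dfx Fv OD -> multi -> L :=
  fun g m => (\prod_(q <- ps) pi_in_L q ^ (- v_weight q)) * Up f g m.

End LocalWeights.

(* The matrix of the operator V of S in the coordinates of the
   identification f |-> (f t_i)_i of S with a direct sum of copies of
   L<X_1, X_2>, with respect to the orthonormal basis of monomials. *)
Definition is_matrix (T : Type) (L : fieldType) (h : nat) (t : 'I_h -> T)
    (S : set (T -> multi -> L)) (V : (T -> multi -> L) -> T -> multi -> L)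
    (M : 'I_h * multi -> 'I_h * multi -> L) : Prop :=
  forall j l, exists f, [/\ S f, forall i m, f (t i) m = ((i, m) == (j, l))%:R &
    forall i m, M (i, m) (j, l) = V f (t i) m].

(* det(1 - X M) = sum_k c_k X^k, as the coefficientwise limit of the
   characteristic series of the finite square submatrices. *)
Definition fredholm_trunc (L : fieldType) (I : choiceType) (M : I -> I -> L)
    (K : {fset I}) : {poly L} :=
  \det (1%:M - 'X *: map_mx polyC
    (\matrix_(i < #|{: K}|, j < #|{: K}|)
       M (fsval (enum_val i)) (fsval (enum_val j)))).

Definition is_fredholm (R : realType) (L : fieldType) (v : L -> \bar R)
    (I : choiceType) (M : I -> I -> L) (c : nat -> L) : Prop :=
  forall k, fset_lim v (fun K => (fredholm_trunc M K)`_k) (c k).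

(* The Fredholm series of V is c. M and c are unique when they exist. *)
Definition is_fredholm_series (R : realType) (T : Type) (L : fieldType)
    (v : L -> \bar R) (h : nat) (t : 'I_h -> T) (S : set (T -> multi -> L))
    (V : (T -> multi -> L) -> T -> multi -> L) (c : nat -> L) : Prop :=
  exists2 M, is_matrix t S V M & is_fredholm v M c.

Section NewtonPolygon.
Variables (R : realType) (L : fieldType) (v : L -> \bar R).

(* The convex hull of the points (m, v (c m)) at finite height. *)
Definition newton_hull (c : nat -> L) : set (R * R) :=
  [set z | exists (n : nat) (m : 'I_n -> nat) (lam : 'I_n -> R),
    [/\ forall k, 0 <= lam k, \sum_k lam k = 1, forall k, c (m k) != 0,
        z.1 = \sum_k lam k * (m k)%:R &
        z.2 = \sum_k lam k * fine (v (c (m k)))]].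

(* Its lower boundary, as a function on the line (+oo off the hull). *)
Definition newton_polygon (c : nat -> L) (x : R) : \bar R :=
  ereal_inf [set y%:E | y in [set y | newton_hull c (x, y)]].

(* The infinite polygon with the given sequence of vertices. *)
Definition polygon (vertex : nat -> R * R) : set (R * R) :=
  [set z | exists (i : nat) (t : R), [/\ 0 <= t, t <= 1,
     z.1 = (1 - t) * (vertex i).1 + t * (vertex i.+1).1 &
     z.2 = (1 - t) * (vertex i).2 + t * (vertex i.+1).2]].

End NewtonPolygon.

Definition bound_vertex (R : realType) (h i : nat) : R * R :=
  (i%:R * (i%:R + 1) * h%:R / 2, (i%:R - 1) * i%:R * (i%:R + 1) * h%:R / 3).

(* Main.v *)
Require Import Defs.
From HB Require Import structures.
From mathcomp Require Import all_boot all_order all_algebra all_field.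
From mathcomp Require Import perm finmap.
From mathcomp Require Import all_classical all_reals ereal.
From mathcomp Require Import ring lra zify.

Set Implicit Arguments.
Unset Strict Implicit.
Unset Printing Implicit Defensive.

Import Order.TTheory GRing.Theory Num.Theory.

Local Open Scope classical_set_scope.
Local Open Scope ring_scope.

(** The proof is an estimate of the matrix of U_p^0 in the basis of monomials.

    Apply U_q to a form whose values have integral coefficients. The matrix
    (pi, 0; alpha pi^s, 1) at q sends X^l to
    pi^w (c X + 1)^(n - l) (pi X)^l with c divisible by p, and since p is
    unramified pi has the valuation of p; so in each variable X_i with
    sigma_i above q the coefficient of X_i^m gains valuation w_i + m
    ([weight_act_hecke]), while the other variables are untouched. After all the
    places above p, and division by the normalising factor, the row of the
    matrix indexed by (t_i, X^m) has valuation at least m_1 + m_2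
    ([matrix_bounded]).

    This bounds the Fredholm series. If rho is a slope, each row of
    1 - X M of degree d costs at most max (rho - d, 0) below the line of slope
    rho, and these costs add up over the rows of a determinant
    ([char_det_growth]). There are h (d + 1) rows of degree d, so the k-th
    coefficient has valuation at least rho k - h rho (rho + 1) (rho + 2) / 6
    ([sum_mdeg], [fredholm_ge]), which is the line carrying the edge of slope
    rho of the polygon ([newton_polygon_ge]). Rows of large degree are close to
    0, so the determinants of the finite submatrices form a Cauchy net and the
    series exists ([fredholm_ex]).

    The other half of the work shows that the matrix exists, that is, that there
    are forms with one monomial as value at one t_j and the value 0 at the
    others. Every g is d t_j u with u in U, and the form with
    value X^l at t_j must take the value X^l . u there ([basis_form]). That this
    satisfies the functional equation is the multiplicativity of the action
    ([mono_act_comp]); that it is well defined is the sufficient smallness of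
    the level: u is unique up to a scalar c in F, which is a unit of the
    integers ([double_coset_unit], which rests on [ringOfInt_local]) and acts by
    psi(c) N(c)^r = N(c)^(2 r) = 1 ([mono_act_scalar]).

    Finally the number of double cosets is the dimension of the space of
    forms of weight [2, 2] ([dim_S2]). *)

(** * Nonarchimedean valuations *)

(** The exponential form of [|x| <= p^-A]. *)
Definition vge (R : realType) (K : fieldType) (v : K -> \bar R) (A : R) (x : K) : Prop :=
  (A%:E <= v x)%E.

Definition ord_multi N (f : {ffun 'I_2 -> 'I_N}) : multi := [ffun i => val (f i)].

Definition multi_box N : {fset multi} := [fset ord_multi f | f in {ffun 'I_2 -> 'I_N}]%fset.

Lemma ord_multi_inj N : injective (@ord_multi N).
Proof.
by move=> f g /ffunP fg; apply/ffunP => i; have := fg i; rewrite /ord_multi !ffunE => /val_inj.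
Qed.

Lemma in_multi_boxP N (m : multi) : reflect (forall i, (m i < N)%N) (m \in multi_box N).
Proof.
apply: (iffP (imfsetP _ _ _ _)) => [[f _ ->] i|mN]; first by rewrite /ord_multi ffunE ltn_ord.
by exists [ffun i => Ordinal (mN i)] => //; apply/ffunP => i; rewrite /ord_multi !ffunE.
Qed.

Section Valuation.
Variables (R : realType) (K : fieldType) (v : K -> \bar R).
Hypothesis vP : is_valuation v.

Lemma val0 : v 0 = +oo%E.
Proof. by apply/(valuation_eqy vP). Qed.

Lemma val_real x : x != 0 -> exists r : R, v x = r%:E.
Proof.
move=> x0; case E: (v x) => [r| |]; first by exists r.
- by move/(valuation_eqy vP): E => /eqP; rewrite (negbTE x0).
- by have := valuation_neqNy vP x; rewrite E.
Qed.

Lemma val_one : v 1 = 0%E.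
Proof.
have [r E] := val_real (oner_neq0 K).
have := valuationM vP 1 1; rewrite mul1r E -EFinD => -[] /eqP.
by rewrite -subr_eq subrr => /eqP <-.
Qed.

Lemma valN1 : v (-1) = 0%E.
Proof.
have n0 : (-1 : K) != 0 by rewrite oppr_eq0 oner_neq0.
have [r E] := val_real n0.
have := valuationM vP (-1) (-1); rewrite mulrNN mul1r E val_one -EFinD => -[] /esym/eqP.
by rewrite -mulr2n mulrn_eq0 /= => /eqP ->.
Qed.

Lemma valN x : v (- x) = v x.
Proof. by rewrite -mulN1r (valuationM vP) valN1 add0e. Qed.

Lemma vge0 A : vge v A 0.
Proof. by rewrite /vge val0 leey. Qed.

Lemma vge1 : vge v 0 1.
Proof. by rewrite /vge val_one. Qed.

Lemma vgeD A x y : vge v A x -> vge v A y -> vge v A (x + y).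
Proof.
rewrite /vge => Ax Ay; apply: le_trans (valuationD vP x y).
by rewrite le_min Ax Ay.
Qed.

Lemma vgeN A x : vge v A (- x) <-> vge v A x.
Proof. by rewrite /vge valN. Qed.

Lemma vgeB A x y : vge v A x -> vge v A y -> vge v A (x - y).
Proof. by move=> Ax Ay; apply: vgeD => //; apply/vgeN. Qed.

Lemma vge_subC A x y : vge v A (x - y) -> vge v A (y - x).
Proof. by move=> Axy; apply/vgeN; rewrite opprB. Qed.

Lemma vge_trans A x y z : vge v A (x - y) -> vge v A (y - z) -> vge v A (x - z).
Proof. by move=> xy yz; have := vgeD xy yz; rewrite addrA subrK. Qed.

Lemma vgeW A B x : B <= A -> vge v A x -> vge v B x.
Proof. by rewrite /vge => BA; apply: le_trans; rewrite lee_fin. Qed.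

Lemma vgeM A B x y : vge v A x -> vge v B y -> vge v (A + B) (x * y).
Proof. by rewrite /vge (valuationM vP) EFinD => ? ?; apply: leeD. Qed.

Lemma vgeMl A x y : vge v 0 x -> vge v A y -> vge v A (x * y).
Proof. by move=> x0 Ay; rewrite -[A]add0r; apply: vgeM. Qed.

Lemma vge_sum I (r : seq I) (P : pred I) A (F : I -> K) :
  (forall i, P i -> vge v A (F i)) -> vge v A (\sum_(i <- r | P i) F i).
Proof. by move=> AF; elim/big_ind: _ => //; [exact: vge0 | exact: vgeD]. Qed.

Lemma vge_sum_seq (I : eqType) (r : seq I) A (F : I -> K) :
  (forall i, i \in r -> vge v A (F i)) -> vge v A (\sum_(i <- r) F i).
Proof. by move=> AF; rewrite big_seq; apply: vge_sum. Qed.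

Lemma vge_prod I (r : seq I) (P : pred I) (A : I -> R) (F : I -> K) :
  (forall i, P i -> vge v (A i) (F i)) ->
  vge v (\sum_(i <- r | P i) A i) (\prod_(i <- r | P i) F i).
Proof.
by move=> AF; elim/big_ind2: _ => // [|? ? ? ? ? ?]; [exact: vge1 | exact: vgeM].
Qed.

Lemma vge_eq0 x : (forall A, vge v A x) -> x = 0.
Proof.
move=> Ax; apply/(valuation_eqy vP); apply/eqP; rewrite -leye_eq.
apply/eqP; case E: (v x) => [r| |] //.
- by have := Ax (r + 1); rewrite /vge E lee_fin; lra.
- by have := Ax 0; rewrite /vge E.
Qed.

Lemma vge_eq x y : (forall A, vge v A (x - y)) -> x = y.
Proof. by move=> /vge_eq0/eqP; rewrite subr_eq0 => /eqP. Qed.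

Lemma valV x (r : R) : v x = r%:E -> v x^-1 = (- r)%:E.
Proof.
move=> E; have x0 : x != 0 by apply/eqP => x0; move: E; rewrite x0 val0.
have [q Eq] := val_real (invr_neq0 x0).
have := valuationM vP x x^-1; rewrite divff // val_one E Eq -EFinD => -[] /esym/eqP.
by rewrite addrC addr_eq0 => /eqP ->.
Qed.

Lemma valV0 x : v x = 0%E -> v x^-1 = 0%E.
Proof. by move/valV; rewrite oppr0. Qed.

Lemma valM0 x y : v x = 0%E -> v y = 0%E -> v (x * y) = 0%E.
Proof. by move=> x0 y0; rewrite (valuationM vP) x0 y0 adde0. Qed.

Lemma valX0 x n : v x = 0%E -> v (x ^+ n) = 0%E.
Proof.
by move=> x0; elim: n => [|n IH]; rewrite ?expr0 ?val_one // exprS valM0.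
Qed.

Lemma val_neq0 x : v x = 0%E -> x != 0.
Proof. by move=> E; apply/eqP => x0; move: E; rewrite x0 val0. Qed.

Lemma valX x (r : R) n : v x = r%:E -> v (x ^+ n) = (n%:R * r)%:E.
Proof.
move=> E; elim: n => [|n IH]; first by rewrite expr0 val_one mul0r.
by rewrite exprS (valuationM vP) E IH -EFinD -natr1 mulrDl mul1r addrC.
Qed.

Lemma valXz x (r : R) (z : int) : v x = r%:E -> v (x ^ z) = (z%:~R * r)%:E.
Proof.
case: z => n E; first by rewrite -exprnP (valX n E).
by rewrite NegzE -exprnN (valV (valX _ E)) mulrNz mulNr.
Qed.

(** In a valuation ring a factor of a unit is a unit. *)
Lemma val_unit_of x y : vge v 0 x -> vge v 0 y -> v (x * y) = 0%E -> v x = 0%E.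
Proof.
rewrite /vge => x0 y0 xy.
have xn0 : x != 0 by apply/eqP => z; move/val_neq0: xy; rewrite z mul0r eqxx.
have yn0 : y != 0 by apply/eqP => z; move/val_neq0: xy; rewrite z mulr0 eqxx.
move: xy x0 y0; rewrite (valuationM vP).
have [r ->] := val_real xn0; have [q ->] := val_real yn0.
by rewrite !lee_fin -EFinD => -[] rq r0 q0; congr (_%:E); lra.
Qed.

Lemma valD_unit x y : v x = 0%E -> (0 < v y)%E -> v (x + y) = 0%E.
Proof.
move=> x0 y0; apply/eqP; rewrite eq_le; apply/andP; split; last first.
  by apply: (@vgeD 0) => //; rewrite /vge ?x0 // ltW.
rewrite leNgt; apply/negP => xy0.
have := valuationD vP (x + y) (- y); rewrite addrK x0 valN.
by rewrite leNgt lt_min xy0 y0.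
Qed.


(** * Convergence of nets, sums and sequences *)

Section Net.
Variable I : choiceType.
Implicit Types (F : {fset I} -> K) (a : I -> K).

Lemma fset_lim_unique F l l' : fset_lim v F l -> fset_lim v F l' -> l = l'.
Proof.
move=> Fl Fl'; apply: vge_eq => A; have [K0 h0] := Fl A; have [K1 h1] := Fl' A.
have /h0 A0 := fsubsetUl K0 K1; have /h1 A1 := fsubsetUr K0 K1.
exact: vge_trans (vge_subC A0) A1.
Qed.

Lemma fset_lim_ge F l A : fset_lim v F l -> (forall J, vge v A (F J)) -> vge v A l.
Proof.
move=> Fl AF; have [K0 /(_ K0 (fsubset_refl _)) h0] := Fl A.
by rewrite -[l](subKr (F K0)); apply: vgeB.
Qed.

(** Completeness is about sequences; for a net it is applied to the values at
    index sets chosen for the precisions 0, 1, 2, etc. *)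
Lemma fset_lim_cauchy F : is_complete v ->
  (forall A, exists K0, forall J, (K0 `<=` J)%fset -> vge v A (F J - F K0)) ->
  exists l, fset_lim v F l.
Proof.
move=> cK cF.
have /choice[K0 hK0] : forall n : nat, exists K0 : {fset I},
    forall J, (K0 `<=` J)%fset -> vge v n%:R (F J - F K0) by move=> n; apply: cF.
have ub (A : R) : exists N : nat, forall n, (N <= n)%N -> A <= n%:R.
  exists (Num.truncn A).+1 => n Nn; have := @truncnS_gt R A.
  by move/ltW/le_trans; apply; rewrite ler_nat.
have [l hl] : exists l : K, forall A : R, exists N, forall n,
    (N <= n)%N -> (A%:E <= v (F (K0 n) - l)%R)%E.
  apply: cK => A; have [N hN] := ub A; exists N => m n Nm Nn.
  apply: (@vge_trans _ _ (F (K0 m `|` K0 n)%fset)).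
    by apply: vge_subC; apply: vgeW (hN _ Nm) _; apply: hK0; exact: fsubsetUl.
  by apply: vgeW (hN _ Nn) _; apply: hK0; exact: fsubsetUr.
exists l => A; have [N hN] := ub A; have [N' hN'] := hl A.
pose n := maxn N N'; exists (K0 n) => J /hK0 hJ.
apply: vge_trans (hN' n (leq_maxr _ _)).
exact: vgeW (hN n (leq_maxl _ _)) hJ.
Qed.

Lemma vsumE a l : is_vsum v a l -> vsum v a = l.
Proof.
move=> al; apply: (@fset_lim_unique (fun J : {fset I} => \sum_(i <- J) a i)) => //.
exact: (@xgetPex _ 0 [set l | is_vsum v a l] (ex_intro _ l al)).
Qed.

(** No convergence is assumed: [vsum] is 0 on a divergent family. *)
Lemma vsum_ge a A : (forall i, vge v A (a i)) -> vge v A (vsum v a).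
Proof.
move=> Aa; rewrite /vsum; case: xgetP => [l _ al|_]; last exact: vge0.
by apply: fset_lim_ge al _ => J; apply: vge_sum.
Qed.

Lemma vsum0 a : (forall i, a i = 0) -> vsum v a = 0.
Proof.
move=> a0; apply: vsumE => A; exists fset0 => J _.
by rewrite big1 // subrr; exact: vge0.
Qed.

End Net.


(** Convergence of the partial sums of a sequence. *)
Definition cvs (x : nat -> K) (l : K) : Prop :=
  forall A, exists N, forall n, (N <= n)%N -> vge v A (\sum_(k < n) x k - l).

Definition null (x : nat -> K) : Prop :=
  forall A, exists N, forall n, (N <= n)%N -> vge v A (x n).

Lemma cvs_unique x l l' : cvs x l -> cvs x l' -> l = l'.
Proof.
move=> xl xl'; apply: vge_eq => A; have [N h] := xl A; have [N' h'] := xl' A.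
have A0 := h _ (leq_maxl N N'); have A1 := h' _ (leq_maxr N N').
exact: vge_trans (vge_subC A0) A1.
Qed.

Lemma cvs_ex x : is_complete v -> null x -> exists l, cvs x l.
Proof.
move=> cK nx; apply: cK => A; have [N hN] := nx A; exists N => m n.
wlog mn : m n / (m <= n)%N => [th Nm Nn|Nm Nn].
  by case/orP: (leq_total m n) => mn; [|apply: vge_subC]; apply: th.
apply: vge_subC; rewrite -!(big_mkord xpredT x) (big_cat_nat (leq0n _) mn) /=.
rewrite [X in X - _]addrC addrK; apply: vge_sum_seq => k; rewrite mem_index_iota => /andP[mk _].
by apply: hN; apply: leq_trans mk.
Qed.

Lemma cvsD x y l l' : cvs x l -> cvs y l' -> cvs (fun k => x k + y k) (l + l').
Proof.
move=> xl yl A; have [N h] := xl A; have [N' h'] := yl A; exists (maxn N N') => n.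
rewrite geq_max => /andP[/h ? /h' ?]; rewrite big_split opprD addrACA.
exact: vgeD.
Qed.

Lemma cvsZ c x l : cvs x l -> cvs (fun k => c * x k) (c * l).
Proof.
have [-> _ A|c0 xl A] := eqVneq c 0.
  by exists 0%N => n _; rewrite big1 => [|i _]; rewrite !mul0r ?subrr //; apply: vge0.
have [r E] := val_real c0.
have [N h] := xl (A - r); exists N => n /h ?.
rewrite -mulr_sumr -mulrBr -[A](subrK r) addrC; apply: vgeM => //.
by rewrite /vge E.
Qed.

Lemma cvs_shift x l : x 0%N = 0 -> cvs (fun k => x k.+1) l <-> cvs x l.
Proof.
move=> x0; split=> xl A; have [N h] := xl A.
  exists N.+1 => -[//|n] Nn; rewrite big_ord_recl x0 add0r; exact: h.
by exists N => n Nn; have := h n.+1 (leqW Nn); rewrite big_ord_recl x0 add0r.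
Qed.

Lemma cvs_null x l : cvs x l -> null x.
Proof.
move=> xl A; have [N h] := xl A; exists N => n Nn.
have := vge_trans (h n.+1 (leqW Nn)) (vge_subC (h n Nn)).
by rewrite big_ord_recr /= [X in X - _]addrC addrK.
Qed.

Lemma cvs_single x k0 : (forall k, k != k0 -> x k = 0) -> cvs x (x k0).
Proof.
move=> xk A; exists k0.+1 => n k0n; rewrite (bigD1 (Ordinal k0n)) //= big1 => [|k kn].
  by rewrite addr0 subrr; apply: vge0.
by apply: xk; apply: contraNneq kn => kk; apply/eqP/val_inj.
Qed.

(** Outside a large square one of the two factors of a term is small, and over a
    square the sum factors into partial sums. *)
Lemma is_vsum_prod (x : 'I_2 -> nat -> K) (l : 'I_2 -> K) :
  (forall i k, vge v 0 (x i k)) -> (forall i, cvs (x i) (l i)) ->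
  is_vsum v (fun m : multi => \prod_i x i (m i)) (\prod_i l i).
Proof.
move=> x0 xl A.
have l0 i : vge v 0 (l i).
  have [N /(_ N (leqnn _)) h] := xl i 0.
  by rewrite -[l i](subKr (\sum_(k < N) x i k)); apply: vgeB => //; apply: vge_sum.
have [N hN] : exists N, forall i n, (N <= n)%N ->
    vge v A (x i n) /\ vge v A (\sum_(k < n) x i k - l i).
  have nx i : exists N, forall n, (N <= n)%N ->
      vge v A (x i n) /\ vge v A (\sum_(k < n) x i k - l i).
    have [N h] := xl i A; have [N' h'] := cvs_null (xl i) A; exists (maxn N N') => n.
    by rewrite geq_max => /andP[/h ? /h' ?].
  have /choice[N hN] := nx; exists (\max_i N i) => i n Nn.
  by apply: (hN i); apply: leq_trans Nn; exact: leq_bigmax.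
exists (multi_box N) => J boxJ.
rewrite (big_fsetID _ (mem (multi_box N))) /=.
have -> : [fset m in J | m \in multi_box N]%fset = multi_box N.
  apply/fsetP => m; rewrite !inE /=; apply/andb_idl; exact: (fsubsetP boxJ).
rewrite addrAC; apply: vgeD; last first.
  apply: vge_sum_seq => m; rewrite !inE /= => /andP[_ mb].
  have [i mi] : exists i, (N <= m i)%N.
    apply: contrapT => nm; apply: (negP mb); apply/in_multi_boxP => i.
    by rewrite ltnNge; apply/negP => mi; apply: nm; exists i.
  rewrite (bigD1 i) //= mulrC; apply: vgeMl; last by have [] := hN i _ mi.
  by have := @vge_prod _ (index_enum 'I_2) (fun j => j != i) (fun => 0)
    (fun j => x j (m j)) (fun j _ => x0 j _); rewrite big1.
rewrite /multi_box big_imfset /=; last first.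
  by move=> f f2 _ _; exact: ord_multi_inj.
have -> : \sum_(f <- enum {ffun 'I_2 -> 'I_N}) \prod_i x i (ord_multi f i) = \prod_i \sum_(k < N) x i k.
  rewrite big_enum /= bigA_distr_bigA /=; apply: eq_bigr => f _.
  by apply: eq_bigr => i _; rewrite ffunE.
rewrite !big_ord_recl !big_ord0 !mulr1.
set a := \sum_(k < N) _; set b := \sum_(k < N) _; set c := l _; set d := l _.
have -> : a * b - c * d = b * (a - c) + c * (b - d) by ring.
apply: vgeD; apply: vgeMl.
- by apply: vge_sum.
- by have [] := hN ord0 _ (leqnn N).
- exact: l0.
- by have [] := hN (lift ord0 ord0) _ (leqnn N).
Qed.

End Valuation.

(** * Power series and the action of one matrix *)

Section Series.
Variable L : fieldType.
Implicit Types (f g h : nat -> L) (a b c d : L) (z : int).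

Lemma eq_ser_mul f f' g g' n :
  (forall k, (k <= n)%N -> f k = f' k) -> (forall k, (k <= n)%N -> g k = g' k) ->
  ser_mul f g n = ser_mul f' g' n.
Proof.
move=> ff gg; apply: eq_bigr => j _; rewrite ff ?gg ?leq_subr //.
by rewrite -ltnS.
Qed.

(** The product of series up to degree [n] is a product of polynomials, which
    transfers commutativity and associativity. *)
Lemma ser_mul_trunc f g N n : (n < N)%N ->
  ser_mul f g n = ((\poly_(i < N) f i) * (\poly_(i < N) g i))`_n.
Proof.
move=> nN; rewrite coefM; apply: eq_ser_mul => k kn;
  by rewrite coef_poly (leq_ltn_trans kn nN).
Qed.

Lemma ser_mulC f g : ser_mul f g = ser_mul g f.
Proof. by apply/funext => n; rewrite !(ser_mul_trunc _ _ (ltnSn n)) mulrC. Qed.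

Lemma ser_mulA f g h : ser_mul f (ser_mul g h) = ser_mul (ser_mul f g) h.
Proof.
apply/funext => n; pose P u := \poly_(i < n.+1) u i : {poly L}.
have coP u k : (k <= n)%N -> u k = (P u)`_k by move=> kn; rewrite coef_poly ltnS kn.
have coM u w k : (k <= n)%N -> ser_mul u w k = (P u * P w)`_k.
  by move=> kn; rewrite (ser_mul_trunc _ _ (_ : (k < n.+1)%N)).
have -> : ser_mul f (ser_mul g h) n = (P f * (P g * P h))`_n.
  by rewrite coefM; apply: eq_ser_mul => k kn; [exact: coP | exact: coM].
have -> : ser_mul (ser_mul f g) h n = (P f * P g * P h)`_n.
  by rewrite coefM; apply: eq_ser_mul => k kn; [exact: coM | exact: coP].
by rewrite mulrA.
Qed.

Lemma ser_mul1 f : ser_mul (@ser_one L) f = f.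
Proof.
apply/funext => n; rewrite /ser_mul big_ord_recl /= mul1r subn0 big1 ?addr0 //.
by move=> i _; rewrite /ser_one /= mul0r.
Qed.

Lemma ser_mulCA f g h : ser_mul f (ser_mul g h) = ser_mul g (ser_mul f h).
Proof. by rewrite !ser_mulA (ser_mulC f). Qed.

Lemma ser_mulZl c f g : ser_mul (fun k => c * f k) g = (fun k => c * ser_mul f g k).
Proof.
by apply/funext => n; rewrite /ser_mul mulr_sumr; apply: eq_bigr => j _; rewrite mulrA.
Qed.

Lemma ser_mulZr c f g : ser_mul f (fun k => c * g k) = (fun k => c * ser_mul f g k).
Proof. by rewrite ser_mulC ser_mulZl ser_mulC. Qed.

(** The product (a X + b) f, as an operator. *)
Definition mlin a b f : nat -> L := fun k => b * f k + (if k is k'.+1 then a * f k' else 0).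

Lemma ser_mul_lin a b f : ser_mul (lin a b) f = mlin a b f.
Proof.
apply/funext => -[|n]; first by rewrite /ser_mul big_ord_recl big_ord0.
rewrite /ser_mul !big_ord_recl /= subn0 subSS subn0 big1 ?addr0 // => i _.
by rewrite mul0r.
Qed.

Lemma mlin_comb x y a b c d f :
  (fun k => x * mlin a b f k + y * mlin c d f k) = mlin (x * a + y * c) (x * b + y * d) f.
Proof. by apply/funext => -[|n]; rewrite /mlin /=; ring. Qed.

Lemma mlin_inj c d f g : d != 0 -> mlin c d f = mlin c d g -> f = g.
Proof.
move=> d0 fg; have fgk k : mlin c d f k = mlin c d g k by rewrite fg.
apply/funext; elim=> [|n IH].
  by have := fgk 0%N; rewrite /mlin !addr0 => /(mulfI d0).
by have := fgk n.+1; rewrite /mlin IH => /addIr/(mulfI d0).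
Qed.

Lemma mlin_lin_inv c d : d != 0 -> mlin c d (lin_inv c d) = ser_one L.
Proof.
move=> d0; apply/funext => -[|n]; rewrite /mlin /lin_inv /ser_one /=.
  by rewrite expr0 mul1r expr1 divff // addr0.
have dn0 : d ^+ n != 0 by rewrite expf_neq0.
by rewrite [(- c) ^+ _]exprS [d ^+ n.+2]exprS [d ^+ n.+1]exprS; field; rewrite d0 dn0.
Qed.

(** The two cases in the definition of [lin_expz] obey one recurrence. *)
Lemma lin_expz1 c d z : d != 0 -> lin_expz c d (z + 1) = mlin c d (lin_expz c d z).
Proof.
move=> d0; case: z => [n|[|n]].
- by rewrite -PoszD addn1 /= ser_mul_lin.
- by rewrite NegzE addNr /= ser_mulC ser_mul1 mlin_lin_inv.
- have -> : Negz n.+1 + 1 = Negz n by lia.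
  by rewrite /= -[in RHS]ser_mul_lin ser_mulA ser_mul_lin mlin_lin_inv // ser_mul1.
Qed.

(** (c X + d)^z ((a X + b) / (c X + d))^l: the image of X^l under a matrix, in
    weight z. *)
Definition moebius z a b c d (l : nat) : nat -> L :=
  ser_mul (lin_expz c d z) (ser_exp (ser_mul (lin a b) (lin_inv c d)) l).

Lemma moebius0 z a b c d : moebius z a b c d 0 = lin_expz c d z.
Proof. by rewrite /moebius ser_mulC ser_mul1. Qed.

Lemma moebiusS z a b c d l : d != 0 ->
  mlin c d (moebius z a b c d l.+1) = mlin a b (moebius z a b c d l).
Proof.
move=> d0; rewrite /moebius /= -!ser_mul_lin.
rewrite -[ser_mul (ser_mul (lin a b) (lin_inv c d)) _]ser_mulA.
rewrite (ser_mulCA _ (lin a b)) (ser_mulCA (lin c d)); congr ser_mul.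
by rewrite (ser_mulCA _ (lin_inv c d)) ser_mulA ser_mul_lin mlin_lin_inv // ser_mul1.
Qed.

Lemma moebius_expz1 z a b c d l : d != 0 ->
  moebius (z + 1) a b c d l = mlin c d (moebius z a b c d l).
Proof. by move=> d0; rewrite /moebius lin_expz1 // -!ser_mul_lin ser_mulA. Qed.

(** The family of the [moebius] series is determined by its value for z = 0 and
    l = 0 and by the recurrences in z and in l: both recurrences can be solved
    because d is invertible. This reduces the composition law to checking
    recurrences. *)
Lemma moebius_unique (G : int -> nat -> nat -> L) a b c d : d != 0 ->
  G 0 0%N = ser_one L ->
  (forall z, G (z + 1) 0%N = mlin c d (G z 0%N)) ->
  (forall z l, mlin c d (G z l.+1) = mlin a b (G z l)) ->
  forall z l, G z l = moebius z a b c d l.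
Proof.
move=> d0 G0 Gz Gl z; elim=> [|l IH]; last first.
  by apply: (@mlin_inj c d) => //; rewrite Gl IH moebiusS.
rewrite moebius0; elim: z => [|n IH|n IH].
- by rewrite G0.
- by rewrite -addn1 PoszD Gz IH -lin_expz1.
- apply: (@mlin_inj c d) => //; rewrite -Gz -lin_expz1 //.
  by have -> : - n.+1%:Z + 1 = - n%:Z by lia.
Qed.

Lemma lin_invZ u c d : lin_inv (u * c) (u * d) = (fun k => u^-1 * lin_inv c d k).
Proof.
apply/funext => k; rewrite /lin_inv -mulrN !exprMn invfM mulrACA; congr (_ * _).
have [->|u0] := eqVneq u 0; first by rewrite exprS mul0r invr0 mulr0.
by rewrite exprSr invfM mulrA divff ?mul1r // expf_neq0.
Qed.

Lemma linZ u c d : lin (u * c) (u * d) = (fun k => u * lin c d k).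
Proof. by apply/funext => -[|[|k]] //=; rewrite mulr0. Qed.

Lemma ser_expZ u f n : ser_exp (fun k => u * f k) n = (fun k => u ^+ n * ser_exp f n k).
Proof.
elim: n => [|n IH]; first by apply/funext => k; rewrite /= mul1r.
by rewrite /= IH ser_mulZl ser_mulZr; apply/funext => k; rewrite exprS mulrA.
Qed.

Lemma lin_expzZ u c d z : lin_expz (u * c) (u * d) z = (fun k => u ^ z * lin_expz c d z k).
Proof.
case: z => n; rewrite /lin_expz; first by rewrite linZ ser_expZ.
by rewrite lin_invZ ser_expZ; apply/funext => k; rewrite NegzE -exprnN exprVn.
Qed.

Lemma moebiusZ u z a b c d l : u != 0 ->
  moebius z (u * a) (u * b) (u * c) (u * d) l = (fun k => u ^ z * moebius z a b c d l k).
Proof.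
move=> u0; have E : ser_mul (lin (u * a) (u * b)) (lin_inv (u * c) (u * d)) =
    ser_mul (lin a b) (lin_inv c d).
  rewrite linZ lin_invZ ser_mulZl ser_mulZr; apply/funext => k.
  by rewrite mulrA mulfV // mul1r.
by rewrite /moebius E lin_expzZ ser_mulZl.
Qed.

(** The identity matrix fixes the monomials. *)
Lemma moebius1 z l k : moebius z 1 0 0 1 l k = (k == l)%:R.
Proof.
have lin01 : lin 0 1 = ser_one L by apply/funext => -[|[|j]].
have inv01 : lin_inv 0 1 = ser_one L.
  by apply/funext => j; rewrite /lin_inv oppr0 expr1n divr1 expr0n.
have exp1 n : ser_exp (ser_one L) n = ser_one L.
  by elim: n => //= n ->; rewrite ser_mul1.
have expz1 : lin_expz 0 1 z = ser_one L.
  by case: z => n; rewrite /lin_expz ?lin01 ?inv01 exp1.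
rewrite /moebius expz1 ser_mul1 inv01 ser_mulC ser_mul1.
elim: l k => [|l IH] k //=; rewrite ser_mul_lin /mlin mul0r add0r.
by case: k => [|k]; rewrite ?IH ?mul1r.
Qed.

End Series.

(** * Growth of coefficients *)

Section Growth.
Variables (R : realType) (L : fieldType) (v : L -> \bar R).
Hypothesis vP : is_valuation v.
Implicit Types (f g : nat -> L) (a b c d : L).

(** The coefficients lie above the line of slope [rho] through [(0, - tau)]. Such
    bounds are stable under products, the defects [tau] being added. *)
Definition growth (rho tau : R) f : Prop := forall k, vge v (k%:R * rho - tau) (f k).

Lemma growth_one rho : growth rho 0 (ser_one L).
Proof.
by case=> [|k]; rewrite /ser_one /=; [rewrite mul0r subrr; apply: vge1|apply: vge0].
Qed.

Lemma growth_mul rho tau tau' f g : growth rho tau f -> growth rho tau' g ->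
  growth rho (tau + tau') (ser_mul f g).
Proof.
move=> hf hg k; apply: vge_sum => // j _.
have -> : k%:R * rho - (tau + tau') =
    (j%:R * rho - tau) + ((k - j)%:R * rho - tau').
  have jk : (j <= k)%N by rewrite -ltnS.
  by rewrite (natrB _ jk); ring.
exact: vgeM.
Qed.

Lemma growth_exp rho tau f n : growth rho tau f -> growth rho (n%:R * tau) (ser_exp f n).
Proof.
move=> hf; elim: n => [|n IH]; first by rewrite mul0r; apply: growth_one.
by rewrite -nat1r mulrDl mul1r; apply: growth_mul.
Qed.

Lemma growth_lin rho tau a b : vge v (rho - tau) a -> vge v (- tau) b ->
  growth rho tau (lin a b).
Proof.
move=> ha hb [|[|k]] /=; first by rewrite mul0r sub0r.
  by rewrite mul1r.
exact: vge0.
Qed.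

Lemma growth_lin_inv rho c d : vge v rho c -> v d = 0%E -> growth rho 0 (lin_inv c d).
Proof.
move=> hc hd k; rewrite subr0 /lin_inv -[_ * rho]addr0; apply: vgeM => //.
  elim: k => [|k IH]; first by rewrite mul0r expr0; apply: vge1.
  by rewrite exprS -nat1r mulrDl mul1r; apply: vgeM => //; apply/vgeN.
by rewrite /vge (valV0 vP) // (valX0 vP).
Qed.

Lemma growth_lin_expz rho c d z : vge v rho c -> v d = 0%E -> growth rho 0 (lin_expz c d z).
Proof.
move=> hc hd; case: z => n; rewrite /lin_expz.
  rewrite -[0](mulr0 n%:R); apply: growth_exp; apply: growth_lin; rewrite ?subr0 //.
  by rewrite oppr0 /vge hd.
by rewrite -[0](mulr0 n.+1%:R); apply: growth_exp; apply: growth_lin_inv.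
Qed.

(** For rho = 1 and tau = 0 this is the gain of valuation in the operators U_q,
    and for tau = rho it shows that the image of X^l lies in the Tate algebra. *)
Lemma growth_moebius rho tau z a b c d l :
  vge v (rho - tau) a -> vge v (- tau) b -> vge v rho c -> v d = 0%E ->
  growth rho (l%:R * tau) (moebius z a b c d l).
Proof.
move=> ha hb hc hd; rewrite -[_ * _]add0r; apply: growth_mul.
  exact: growth_lin_expz.
apply: growth_exp; rewrite -[tau]addr0; apply: growth_mul; last exact: growth_lin_inv.
exact: growth_lin.
Qed.

End Growth.

(** * Substitution and the composition law *)

Section Composition.
Variables (R : realType) (L : fieldType) (v : L -> \bar R).
Hypotheses (vP : is_valuation v) (cL : is_complete v).
Variables (a b c d : L).
Hypotheses (a_int : vge v 0 a) (b_int : vge v 0 b) (c_int : vge v 0 c) (d_unit : v d = 0%E).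

Implicit Types (f g : nat -> L) (x y u : L) (z : int).

Let d0 : d != 0 := val_neq0 vP d_unit.

Lemma moebius_int z l k : vge v 0 (moebius z a b c d l k).
Proof.
have := @growth_moebius _ _ _ vP 0 0 z a b c d l; rewrite !subr0 oppr0.
by move=> /(_ a_int b_int c_int d_unit k); rewrite !mulr0 subrr.
Qed.

(** (c X + d)^z f((a X + b) / (c X + d)) for a series f with coefficients tending
    to 0. *)
Definition msubst z (f : nat -> L) : nat -> L :=
  fun m => xget 0 [set l | cvs v (fun k => f k * moebius z a b c d k m) l].

Lemma cvs_msubst z f m : null v f ->
  cvs v (fun k => f k * moebius z a b c d k m) (msubst z f m).
Proof.
move=> nf; apply: (@xgetPex _ 0 [set l | cvs v _ l]); apply: cvs_ex => // A.
have [N h] := nf A; exists N => k /h fk; rewrite mulrC; apply: vgeMl => //.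
exact: moebius_int.
Qed.

Lemma msubstE z f m l : null v f ->
  cvs v (fun k => f k * moebius z a b c d k m) l -> msubst z f m = l.
Proof. by move=> nf; apply: cvs_unique => //; apply: cvs_msubst. Qed.

Definition ser_shift (f : nat -> L) : nat -> L := fun k => if k is k'.+1 then f k' else 0.

Lemma null_ser_shift f : null v f -> null v (ser_shift f).
Proof. by move=> nf A; have [N h] := nf A; exists N.+1 => -[//|k] /h. Qed.

Lemma null_comb x y f g : null v f -> null v g -> null v (fun k => x * f k + y * g k).
Proof.
have nZ u w : null v w -> null v (fun k => u * w k).
  move=> nw; have [->|u0] := eqVneq u 0.
    by move=> A; exists 0%N => k _; rewrite mul0r; apply: vge0.
  have [r E] := val_real vP u0; move=> A; have [N h] := nw (A - r); exists N => k /h wk.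
  by rewrite -[A](subrK r) addrC; apply: vgeM => //; rewrite /vge E.
move=> nf ng A; have [N h] := nZ x f nf A; have [N' h'] := nZ y g ng A.
by exists (maxn N N') => k; rewrite geq_max => /andP[/h ? /h' ?]; apply: vgeD.
Qed.

Lemma mlin_shift x y f : mlin x y f = (fun k => y * f k + x * ser_shift f k).
Proof. by apply/funext => -[|k]; rewrite /mlin /ser_shift ?mulr0. Qed.

Lemma null_mlin x y f : null v f -> null v (mlin x y f).
Proof. by move=> nf; rewrite mlin_shift; apply: null_comb => //; apply: null_ser_shift. Qed.

Lemma msubst_comb z x y f g : null v f -> null v g ->
  msubst z (fun k => x * f k + y * g k) = (fun m => x * msubst z f m + y * msubst z g m).
Proof.
move=> nf ng; apply/funext => m; apply: msubstE; first exact: null_comb.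
have := cvsD vP (cvsZ vP x (cvs_msubst z m nf)) (cvsZ vP y (cvs_msubst z m ng)).
by congr cvs; apply/funext => k; ring.
Qed.

Lemma cvs_mlin x y (F : nat -> nat -> L) l m :
  (forall j, cvs v (fun k => F k j) (l j)) ->
  cvs v (fun k => mlin x y (F k) m) (mlin x y l m).
Proof.
move=> Fl; case: m => [|m]; rewrite /mlin; last by apply: cvsD => //; apply: cvsZ.
rewrite addr0 (_ : (fun k => _) = (fun k => y * F k 0%N)); first exact: cvsZ.
by apply/funext => k; rewrite addr0.
Qed.

Lemma mlinZ x y u f : mlin x y (fun k => u * f k) = (fun k => u * mlin x y f k).
Proof. by apply/funext => -[|k]; rewrite /mlin; ring. Qed.

(** Substituting in (x X + y) f multiplies the result by
    x (a X + b) / (c X + d) + y; the identity is stated without the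
    denominator. *)
Lemma msubst_mlin z x y f : null v f ->
  mlin c d (msubst z (mlin x y f)) = mlin (y * c + x * a) (y * d + x * b) (msubst z f).
Proof.
move=> nf; rewrite [mlin x y f]mlin_shift msubst_comb //; last exact: null_ser_shift.
(* By linearity the case of X f is enough: it is a shift of the index of summation. *)
suff shE : mlin c d (msubst z (ser_shift f)) = mlin a b (msubst z f).
  rewrite -mlin_comb -shE; apply/funext => -[|m]; rewrite /mlin; ring.
apply/funext => m.
have h2 := @cvs_mlin a b (fun k j => f k * moebius z a b c d k j) _ m
  (fun j => cvs_msubst z j nf).
apply: (cvs_unique vP _ h2).
have := @cvs_mlin c d (fun k j => ser_shift f k * moebius z a b c d k j) _ m
  (fun j => cvs_msubst z j (null_ser_shift nf)).
rewrite -cvs_shift; last by case: m {h2} => [|m]; rewrite /mlin /= !mul0r !mulr0 addr0.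
congr cvs; apply/funext => k; rewrite /= !mlinZ moebiusS //.
Qed.

Lemma msubst_expz1 z f : null v f -> msubst (z + 1) f = mlin c d (msubst z f).
Proof.
move=> nf; apply/funext => m; apply: msubstE => //.
have := @cvs_mlin c d (fun k j => f k * moebius z a b c d k j) _ m
  (fun j => cvs_msubst z j nf).
by congr cvs; apply/funext => k; rewrite mlinZ moebius_expz1.
Qed.

Lemma msubst_one : msubst 0 (ser_one L) = ser_one L.
Proof.
have nf : null v (ser_one L).
  by move=> A; exists 1%N => -[//|k] _; apply: vge0.
apply/funext => m; apply: msubstE => //.
have := @cvs_single _ _ _ vP (fun k => ser_one L k * moebius 0 a b c d k m) 0%N.
rewrite moebius0 mul1r; apply => -[//|k] _.
by rewrite mul0r.
Qed.

End Composition.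

Section CompositionOfMoebius.
Variables (R : realType) (L : fieldType) (v : L -> \bar R).
Hypotheses (vP : is_valuation v) (cL : is_complete v).

Lemma growth_null rho tau (f : nat -> L) : 0 < rho -> growth v rho tau f -> null v f.
Proof.
move=> rho0 hf A; exists (Num.truncn ((A + tau) / rho)).+1 => n Nn.
apply: vgeW (hf n); rewrite lerBrDr -ler_pdivrMr //.
have := @truncnS_gt R ((A + tau) / rho); move/ltW/le_trans; apply.
by rewrite ler_nat.
Qed.

(** The substitution of the second matrix in the family of the first one satisfies
    the recurrences of the family of the product. *)
Lemma moebius_comp z l m rho (a b c d a' b' c' d' : L) :
  0 < rho ->
  vge v 0 a -> vge v 0 b -> vge v rho c -> v d = 0%E ->
  vge v 0 a' -> vge v 0 b' -> vge v rho c' -> v d' = 0%E ->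
  cvs v (fun k => moebius z a b c d l k * moebius z a' b' c' d' k m)
    (moebius z (a * a' + b * c') (a * b' + b * d') (c * a' + d * c') (c * b' + d * d') l m).
Proof.
move=> rho0 ia ib ic ud ia' ib' ic' ud'.
have c'_int : vge v 0 c' by apply: vgeW ic'; exact: ltW.
have d0 := val_neq0 vP ud.
have nF y n : null v (moebius y a b c d n).
  have ia1 : vge v (rho - rho) a by rewrite subrr.
  have ib1 : vge v (- rho) b by apply: vgeW ib; rewrite oppr_le0 ltW.
  exact: growth_null rho0 (growth_moebius vP y n ia1 ib1 ic ud).
have ud2 : v (c * b' + d * d') = 0%E.
  rewrite addrC; apply: valD_unit => //; first exact: valM0.
  have : vge v rho (c * b') by rewrite mulrC; apply: vgeMl.
  by rewrite /vge; apply: lt_le_trans; rewrite lte_fin.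
have <- : msubst v a' b' c' d' z (moebius z a b c d l) = moebius z
    (a * a' + b * c') (a * b' + b * d') (c * a' + d * c') (c * b' + d * d') l.
  apply: (@moebius_unique _ (fun y n => msubst v a' b' c' d' y (moebius y a b c d n))).
  - exact: (val_neq0 vP ud2).
  - by rewrite moebius0 msubst_one.
  - move=> y; rewrite !moebius0 lin_expz1 // -(moebius0 y a b) msubst_expz1 //; last exact: null_mlin.
    by rewrite msubst_mlin //; congr mlin; rewrite addrC.
  - move=> y n.
    have := msubst_mlin vP cL ia' ib' c'_int ud' y c d (nF y n.+1).
    rewrite moebiusS // msubst_mlin // => E.
    rewrite [c * a' + _]addrC [c * b' + _]addrC -E.
    by congr mlin; rewrite addrC.
exact: cvs_msubst.
Qed.

End CompositionOfMoebius.

(** * Integrality at all places *)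

Section IntegersOfNumberField.
Variable F : fieldExtType rat.
Implicit Types (x y : F) (I J : set F).

Lemma ringOfInt_int (z : int) : @ringOfInt F z%:~R.
Proof. exact: (integral_id (intr : {rmorphism int -> F})). Qed.

Lemma ringOfIntD x y : ringOfInt x -> ringOfInt y -> ringOfInt (x + y).
Proof. exact: (@integral_add _ _ (intr : {rmorphism int -> F})). Qed.

Lemma ringOfIntB x y : ringOfInt x -> ringOfInt y -> ringOfInt (x - y).
Proof. exact: (@integral_sub _ _ (intr : {rmorphism int -> F})). Qed.

Lemma ringOfIntM x y : ringOfInt x -> ringOfInt y -> ringOfInt (x * y).
Proof. exact: (@integral_mul _ _ (intr : {rmorphism int -> F})). Qed.

Lemma ringOfInt_quadratic x (t n : int) :
  x ^+ 2 - t%:~R * x + n%:~R = 0 -> ringOfInt x.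
Proof.
move=> xtn; exists (('X - t%:P) * 'X + n%:P).
  have sz : (size (n%:P : {poly int}) < size (('X - t%:P) * 'X)%R)%N.
    by rewrite size_mulX ?monic_neq0 ?monicXsubC // size_XsubC size_polyC; case: eqP.
  by rewrite monicE lead_coefDl // -monicE monicMr ?monicX ?monicXsubC.
apply/rootP; rewrite rmorphD rmorphM rmorphB /= !map_polyC map_polyX !hornerE.
by rewrite -xtn; ring.
Qed.

(** A maximal element among the sets [A] such that [J `|` A] is a proper ideal
    gives a maximal ideal; taking unions with [J] makes the empty chain
    harmless. *)
Lemma prime_ideal_above J : is_ideal J -> ~ J 1 -> (exists2 x, J x & x != 0) ->
  exists q : place F, J `<=` q.
Proof.
move=> J_ideal J1 [x0 Jx0 x0n].
pose P : set (set F) := [set B | is_ideal (J `|` B) /\ ~ (J `|` B) 1].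
have [|A [[A_ideal A1] Amax]] := @Zorn_bigcup F P.
  move=> C CP totC.
  have common x y : (J `|` \bigcup_(X in C) X) x -> (J `|` \bigcup_(X in C) X) y ->
      exists2 B, is_ideal B /\ B `<=` J `|` \bigcup_(X in C) X & B x /\ B y.
    have sub B : C B -> is_ideal (J `|` B) /\ J `|` B `<=` J `|` \bigcup_(X in C) X.
      move=> CB; split; first by have [] := CP _ CB.
      by apply: setUS => z Bz; exists B.
    move=> [Jx|[B CB Bx]] [Jy|[B' CB' By]].
    - by exists J => //; split=> // z Jz; left.
    - by exists (J `|` B'); [exact: sub | split; [left|right]].
    - by exists (J `|` B); [exact: sub | split; [right|left]].
    - have [BB'|B'B] := totC _ _ CB CB'.
        by exists (J `|` B'); [exact: sub | split; right => //; exact: BB'].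
      by exists (J `|` B); [exact: sub | split; right => //; exact: B'B].
  split; last first.
    by move=> [/J1 //|[B CB B1]]; have [_] := CP _ CB; apply; right.
  have J0 : J 0 by case: J_ideal.
  split=> [x Jx||x y Jx Jy|x y Ox Jy].
  - by have [B [[BO _ _ _] _] [Bx _]] := common _ _ Jx Jx; exact: BO.
  - by left.
  - by have [B [[_ _ BD _] BJ] [Bx By]] := common _ _ Jx Jy; apply: BJ; exact: BD.
  - by have [B [[_ _ _ BM] BJ] [_ By]] := common _ _ Jy Jy; apply: BJ; exact: BM.
set I := J `|` A in A_ideal A1 *.
have [IO I0 ID IM] := A_ideal.
suff I_prime : is_prime_ideal I.
  have I_n0 : exists2 x, I x & x != 0 by exists x0 => //; left.
  by exists (Place I_prime I_n0) => x Jx; left.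
split=> // x y Ox Oy Ixy; apply: contrapT => /not_orP[Ix Iy].
pose B := [set i + r * x | i in I & r in [set r | ringOfInt r]].
have IB : I `<=` B.
  by move=> i Ii; exists i => //; exists 0; rewrite ?mul0r ?addr0 //; exact: (ringOfInt_int 0).
have B_ideal : is_ideal B.
  split=> [_ [i Ii [r Or <-]]||_ _ [i Ii [r Or <-]] [j Ij [s Os <-]]|z _ Oz [i Ii [r Or <-]]].
  - by apply: ringOfIntD; [exact: IO | exact: ringOfIntM].
  - exact: IB.
  - exists (i + j); first exact: ID.
    by exists (r + s); [exact: ringOfIntD | rewrite mulrDl addrACA].
  - exists (z * i); first exact: IM.
    by exists (z * r); [exact: ringOfIntM | rewrite mulrDr mulrA].
have JB : J `|` B = B by apply/setUidPr => z Jz; apply: IB; left.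
have [i Ii [r Or E]] : B 1.
  apply: contrapT => B1; apply: (Amax B); last by rewrite /P /mkset JB; split.
  split=> [z Az|BA]; first by apply: IB; right.
  apply: Ix; right; apply: BA; exists 0 => //; exists 1; rewrite ?mul1r ?add0r //.
  exact: (ringOfInt_int 1).
apply: Iy; rewrite -[y]mul1r -E mulrDl; apply: ID; first by rewrite mulrC; apply: IM.
by rewrite -mulrA; apply: IM.
Qed.

Hypothesis F2 : \dim {:F} = 2%N.

Lemma quadratic_basis x y : x \notin <[1]>%VS -> exists a b : rat, y = a *: x + b%:A.
Proof.
move=> x1; have fx : free [:: x; 1].
  by rewrite free_cons span_seq1 x1 seq1_free oner_neq0.
have : y \in span [:: x; 1].
  by rewrite (@span_basis _ _ {:F}) ?memvf // basisEfree fx subvf F2.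
by rewrite span_cons span_seq1 => /memv_addP[_ /vlineP[a ->] [_ /vlineP[b ->] ->]]; exists a, b.
Qed.

Lemma denq_alg (a : rat) : a%:A * (denq a)%:~R = (numq a)%:~R :> F.
Proof.
by rewrite -in_algE -(rmorph_int (in_alg F)) -rmorphM -numqE rmorph_int.
Qed.

Lemma primitive_quadratic x : exists D t n : int,
  D%:~R * x ^+ 2 - t%:~R * x + n%:~R = 0 /\
  exists a b c : int, a * D + b * t + c * n = 1.
Proof.
have [a [b xab]] : exists a b : rat, x ^+ 2 = a%:A * x + b%:A.
  have [/vlineP[k ->]|/quadratic_basis] := boolP (x \in <[1]>%VS).
    by exists k, 0; rewrite scale0r addr0 expr2.
  by move=> /(_ (x ^+ 2))[a [b ->]]; exists a, b; rewrite mulr_algl.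
(* Clear denominators, then divide by the content. *)
pose D := denq a * denq b; pose t := numq a * denq b; pose n := - (numq b * denq a).
have D0 : D != 0 by rewrite mulf_neq0 ?denq_neq0.
have E : D%:~R * x ^+ 2 - t%:~R * x + n%:~R = 0.
  rewrite xab /D /t /n rmorphN !rmorphM /= -!denq_alg; ring.
pose g := gcdz (gcdz D t) n.
have g0 : g != 0 by rewrite /g !gcdz_eq0 (negbTE D0).
have [D' DE] : exists D', D = D' * g.
  by apply/dvdzP/(dvdz_trans (dvdz_gcdl _ _))/dvdz_gcdl.
have [t' tE] : exists t', t = t' * g.
  by apply/dvdzP/(dvdz_trans (dvdz_gcdl _ _))/dvdz_gcdr.
have [n' nE] : exists n', n = n' * g by apply/dvdzP/dvdz_gcdr.
have [c [c' gE]] := Bezoutz (gcdz D t) n; have [d [d' gE']] := Bezoutz D t.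
have gF : (g%:~R : F) != 0.
  by rewrite -(rmorph_int (in_alg F)) fmorph_eq0 intr_eq0.
exists D', t', n'; split; last first.
  exists (c * d), (c * d'), c'; apply: (mulIf g0).
  rewrite mul1r [RHS](_ : g = c * (d * D + d' * t) + c' * n); last by rewrite gE' gE.
  by rewrite [in RHS]DE [in RHS]tE [in RHS]nE; ring.
apply: (mulIf gF); rewrite mul0r -[RHS]E DE tE nE !rmorphM /=. ring.
Qed.

Variables (R : realType) (Fv : forall q : place F, completion R q).

Lemma cval_intr_ge0 (q : place F) (z : int) : vge (@cval _ _ _ (Fv q)) 0 z%:~R.
Proof.
by rewrite /vge -(rmorph_int (cmap (Fv q))); apply: cval_ge0; exact: ringOfInt_int.
Qed.

(** Let D x^2 - t x + n = 0 be a primitive integral equation, and put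
    y' = t - D x, so that y' x = n. If D and y' generate the unit ideal, then
    multiplying a relation r D + u y' = 1 by x shows that x is integral. Otherwise
    they lie in a prime q. If x were integral at q, then D, t = y' + D x and
    n = y' x would all have positive valuation at q, and D, t, n would not be
    coprime. *)
Lemma ringOfInt_local x : (forall q, vge (@cval _ _ _ (Fv q)) 0 (cmap (Fv q) x)) -> ringOfInt x.
Proof.
move=> x_loc; have [D [t [n [E [a [b [c abc]]]]]]] := primitive_quadratic x.
pose y := D%:~R * x; pose y' := t%:~R - y.
have Oy : ringOfInt y.
  apply: (@ringOfInt_quadratic _ t (n * D)).
  by rewrite -(mulr0 D%:~R) -[in RHS]E /y rmorphM /=; ring.
have Oy' : ringOfInt y' by apply: ringOfIntB => //; exact: ringOfInt_int.
have y'x : y' * x = n%:~R.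
  by apply/eqP; rewrite -subr_eq0 -oppr_eq0 -E /y' /y; apply/eqP; ring.
pose J := [set r * D%:~R + s * y' | r in [set r | ringOfInt r] & s in [set s | ringOfInt s]].
apply: contrapT => nOx.
have DJ : J D%:~R.
  by exists 1; [exact: (ringOfInt_int 1)|exists 0; [exact: (ringOfInt_int 0)|rewrite mul1r mul0r addr0]].
have y'J : J y'.
  by exists 0; [exact: (ringOfInt_int 0)|exists 1; [exact: (ringOfInt_int 1)|rewrite mul1r mul0r add0r]].
have J_ideal : is_ideal J.
  split=> [_ [r Or [u Ou <-]]||_ _ [r Or [u Ou <-]] [r' Or' [u' Ou' <-]]|z _ Oz [r Or [u Ou <-]]].
  - by apply: ringOfIntD; apply: ringOfIntM => //; exact: ringOfInt_int.
  - exists 0; first exact: (ringOfInt_int 0).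
    by exists 0; [exact: (ringOfInt_int 0)|rewrite !mul0r addr0].
  - exists (r + r'); first exact: ringOfIntD.
    by exists (u + u'); [exact: ringOfIntD|ring].
  - exists (z * r); first exact: ringOfIntM.
    by exists (z * u); [exact: ringOfIntM|ring].
have J1 : ~ J 1.
  move=> [r Or [u Ou ru]]; apply: nOx; rewrite -[x]mul1r -ru.
  have -> : (r * D%:~R + u * y') * x = r * y + u * n%:~R by rewrite -y'x /y; ring.
  apply: ringOfIntD; apply: ringOfIntM => //; exact: ringOfInt_int.
have Jn0 : exists2 z, J z & z != 0.
  have [D0|Dn0] := eqVneq (D%:~R : F) 0; last by exists D%:~R.
  exists y' => //; apply/eqP => y'0; have y0 : y = 0 by rewrite /y D0 mul0r.
  move: y'0 y'x; rewrite /y' y0 subr0 => t0; rewrite t0 mul0r => n0.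
  have : ((a * D + b * t + c * n)%:~R : F) = 0.
    by rewrite !rmorphD !rmorphM /= D0 t0 -n0 !mulr0 !addr0.
  by rewrite abc => /eqP; rewrite oner_eq0.
have [q Jq] := prime_ideal_above J_ideal J1 Jn0.
pose w := @cval _ _ _ (Fv q); pose wP := cval_valuation (Fv q).
have wpos z : (0 < w (cmap (Fv q) z))%E <-> exists2 e, (0 < e)%R & vge w e (cmap (Fv q) z).
  split=> [|[e e0]]; last by rewrite /vge; apply: lt_le_trans; rewrite lte_fin.
  have [->|zn0] := eqVneq z 0; first by exists 1 => //; rewrite rmorph0; apply: vge0.
  have zn : cmap (Fv q) z != 0 by rewrite fmorph_eq0.
  have [r rE] : exists r : R, w (cmap (Fv q) z) = r%:E := val_real wP zn.
  by rewrite /vge rE lte_fin => r0; exists r.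
have Dpos : (0 < w (cmap (Fv q) D%:~R))%E.
  by apply/cval_gt0; [exact: ringOfInt_int | exact: Jq].
have y'pos : (0 < w (cmap (Fv q) y'))%E by apply/cval_gt0; [ | exact: Jq].
have [d d0 Dd] := (wpos _).1 Dpos; have [e e0 ye] := (wpos _).1 y'pos.
pose k := Num.min d e.
have k0 : 0 < k by rewrite lt_min d0.
have Dk : vge w k (cmap (Fv q) D%:~R) by apply: vgeW Dd; rewrite ge_min lexx.
have yk : vge w k (cmap (Fv q) y') by apply: vgeW ye; rewrite ge_min lexx orbT.
have tk : vge w k (cmap (Fv q) t%:~R).
  have -> : t%:~R = y' + D%:~R * x by rewrite /y' /y; ring.
  rewrite rmorphD rmorphM /=; apply: vgeD => //.
  by rewrite mulrC; apply: vgeMl => //; exact: x_loc.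
have nk : vge w k (cmap (Fv q) n%:~R).
  by rewrite -y'x rmorphM mulrC; apply: vgeMl => //; exact: x_loc.
have : vge w k 1.
  rewrite -(rmorph1 (cmap (Fv q))) -[1]/(1%:~R) -abc !rmorphD !rmorphM !rmorph_int.
  rewrite !rmorph_int in Dk tk nk.
  by apply: (vgeD wP); [apply: (vgeD wP)|]; apply: (vgeMl wP) => //; exact: cval_intr_ge0.
by rewrite /vge /w (val_one wP) lee_fin leNgt k0.
Qed.

End IntegersOfNumberField.

(** * Norms of units *)

Lemma rat_integral (q : rat) : integralOver (intr : int -> rat) q -> exists m : int, q = m%:~R.
Proof.
case=> p p_mon pq.
have : (ratr q : algC) \in Num.int.
  apply: Cint_rat_Aint; first exact: Crat_rat.
  apply: (@root_monic_Aint (map_poly intr p)).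
  - have -> : map_poly intr p = map_poly ratr (map_poly intr p) :> {poly algC}.
      by rewrite -map_poly_comp; apply: eq_map_poly => z /=; rewrite ratr_int.
    by rewrite fmorph_root.
  - exact: monic_map.
  - by apply/polyOverP => i; rewrite coef_map /= rpred_int.
case/intrP => m qm; exists m.
by apply: (fmorph_inj (ratr : {rmorphism rat -> algC})); rewrite /= qm ratr_int.
Qed.

Section UnitNorm.
Variables (F : fieldExtType rat) (L : fieldType) (sigma : 'I_2 -> {rmorphism F -> L}).
Hypotheses (F2 : \dim {:F} = 2%N) (sigma_distinct : exists x, sigma ord0 x <> sigma ord_max x).

(** The product of the two embeddings is a rational number, by symmetry in the
    roots of the equation of a generator, and it is integral over the
    integers. *)
Lemma norm_integral c : ringOfInt c -> exists m : int, \prod_i sigma i c = m%:~R.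
Proof.
move=> Oc; have [x0 /eqP x0n] := sigma_distinct.
pose f : {rmorphism rat -> L} := GRing.RMorphism.clone _ _ (sigma ord0 \o in_alg F) _.
have sZ i (k : rat) x : sigma i (k *: x) = f k * sigma i x.
  by rewrite rmorphZ_num fmorph_eq_rat.
(* All embeddings agree on the rationals, so x0 generates F. *)
have x01 : x0 \notin <[1]>%VS.
  by apply: contra x0n => /vlineP[k ->]; rewrite !sZ !rmorph1.
have [a [b cE]] := quadratic_basis F2 c x01.
have [A [B x2E]] := quadratic_basis F2 (x0 ^+ 2) x01.
have s2 i : sigma i x0 ^+ 2 = f A * sigma i x0 + f B.
  by rewrite -rmorphXn x2E rmorphD !sZ rmorph1 mulr1.
have sc i : sigma i c = f a * sigma i x0 + f b.
  by rewrite cE rmorphD !sZ rmorph1 mulr1.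
set u := sigma ord0 x0 in x0n; set w := sigma ord_max x0 in x0n.
have uw : u + w = f A.
  apply: (mulIf (_ : u - w != 0)); first by rewrite subr_eq0.
  have := s2 ord0; have := s2 ord_max; rewrite -/u -/w => wE uE.
  have -> : (u + w) * (u - w) = u ^+ 2 - w ^+ 2 by ring.
  by rewrite uE wE; ring.
have uwp : u * w = - f B.
  have := s2 ord0; rewrite -/u -uw => uE.
  have -> : u * w = (u + w) * u - u ^+ 2 by ring.
  by rewrite uE; ring.
have yE : \prod_i sigma i c = f (b ^+ 2 + a * b * A - a ^+ 2 * B).
  rewrite big_ord_recl big_ord1.
  have -> : lift ord0 ord0 = ord_max :> 'I_2 by apply/val_inj.
  rewrite !sc -/u -/w rmorphB rmorphD !rmorphM -uw.
  have -> : f B = - (u * w) by rewrite uwp opprK.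
  ring.
have : integralOver (intr : int -> L) (\prod_i sigma i c).
  have sO i : integralOver (intr : int -> L) (sigma i c).
    have := integral_rmorph (sigma i) Oc; congr (integralOver _ _).
    by apply/funext => z /=; rewrite rmorph_int.
  by rewrite big_ord_recl big_ord1; apply: (@integral_mul _ _ (intr : {rmorphism int -> L})).
rewrite yE => -[p p_mon py].
have [m ->] : exists m : int, b ^+ 2 + a * b * A - a ^+ 2 * B = m%:~R.
  apply: rat_integral; exists p => //.
  rewrite -(fmorph_root f) -map_poly_comp; move: py; congr (root _ _).
  by apply: eq_map_poly => z /=; rewrite -(rmorph_int f).
by exists m; rewrite rmorph_int.
Qed.

Lemma norm_unit_sqr c : unitOfInt c -> (\prod_i sigma i c) ^+ 2 = 1.
Proof.
case=> c0 /norm_integral[m mE] /norm_integral[m' mE'].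
have mm' : (m * m')%:~R = 1 :> F.
  apply: (fmorph_inj (sigma ord0)); rewrite rmorph_int rmorph1 rmorphM /= -mE -mE'.
  rewrite -big_split big1 //= => i _.
  by rewrite fmorphV divff // fmorph_eq0.
have {}mm' : m * m' = 1.
  apply: (@intr_inj rat).
  by apply: (fmorph_inj (in_alg F)); rewrite rmorph_int rmorph1.
have mm : m ^+ 2 = 1.
  have : (`|m| * `|m'| = 1)%N by rewrite -abszM mm'.
  move/eqP; rewrite muln_eq1 => /andP[m1 _]; have : m = 1 \/ m = -1 by lia.
  by case=> ->.
by rewrite mE -rmorphXn mm rmorph1.
Qed.

End UnitNorm.

(** * The action of the Iwahori monoid on monomials *)

Lemma lift2 : lift ord0 ord0 = ord_max :> 'I_2.
Proof. exact/val_inj. Qed.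

Lemma big_ord2 (T : nmodType) (f : 'I_2 -> T) : \sum_i f i = f ord0 + f ord_max.
Proof. by rewrite big_ord_recl big_ord1 lift2. Qed.

Lemma mulmx2E (K : pzRingType) (A B : 'M[K]_2) i j :
  (A *m B) i j = A i ord0 * B ord0 j + A i ord_max * B ord_max j.
Proof. by rewrite mxE big_ord2. Qed.

Lemma det_mx2 (K : comNzRingType) (A : 'M[K]_2) :
  \det A = A ord0 ord0 * A ord_max ord_max - A ord0 ord_max * A ord_max ord0.
Proof.
rewrite (expand_det_row _ ord0) big_ord2 /cofactor !det_mx11 !mxE /= expr0 mul1r expr1.
have -> : lift ord0 0 = ord_max :> 'I_2 by apply/val_inj.
have -> : lift ord_max 0 = ord0 :> 'I_2 by apply/val_inj.
ring.
Qed.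

Section LocalAction.
Variables (R : realType) (F : fieldExtType rat) (p : nat).
Variable Fv : forall q : place F, completion R q.
Hypothesis p_unramified : unramified Fv p.
Variables (L : fieldType) (v : L -> \bar R).
Hypotheses (vP : is_valuation v) (cL : is_complete v) (vp : v p%:R = 1%:E).
Variables (pl : 'I_2 -> pplace F p) (sigma : 'I_2 -> {rmorphism F -> L}).
Variable sigma_hat : forall i, {rmorphism Fv (pl i) -> L}.
Hypothesis sigma_ext : forall i, is_extension v (sigma i) (sigma_hat i).
Variables (n w : 'I_2 -> int) (r : int) (psi : Fp p Fv -> L) (s : nat).
Hypotheses (weight : forall i, n i + 2 * w i = r) (s_ge1 : (1 <= s)%N).
Hypothesis psi_char : is_character s psi.

Implicit Types (q : pplace F p) (g : forall q : pplace F p, 'M[Fv q]_2).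

Let cP (q : place F) : is_valuation (@cval _ _ _ (Fv q)) := cval_valuation (Fv q).

(** Continuity gives the inequality for units: if sigma(y) had negative
    valuation, p^m y^k would be mapped to elements of negative valuation for
    some fixed large m and all large k. As p is unramified, every element is a
    unit times a power of p. *)
Lemma val_sigma_hat i x : v (sigma_hat i x) = cval x.
Proof.
have unit_ge0 y : cval y = 0%E -> vge v 0 (sigma_hat i y).
  move=> y0; have yn0 := val_neq0 (cP (pl i)) y0.
  have [e E] : exists e : R, v (sigma_hat i y) = e%:E.
    by apply: val_real => //; rewrite fmorph_eq0.
  rewrite /vge E lee_fin leNgt; apply/negP => e0.
  have [B hB] := (sigma_ext i).2 0.
  have [m mB] : exists m : nat, B < m%:R.
    by exists (Num.truncn B).+1; apply: truncnS_gt.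
  have [k kB] : exists k : nat, m%:R + k%:R * e < 0.
    exists (Num.truncn (m%:R / - e)).+1.
    have := @truncnS_gt R (m%:R / - e); rewrite ltr_pdivrMr ?oppr_gt0 //; lra.
  have := hB (p%:R ^+ m * y ^+ k).
  rewrite (valuationM (cP _)) (valX (cP _) m (p_unramified (pl i))) (valX (cP _) k y0).
  rewrite mulr1 mulr0 adde0 => /(_ (ltW mB)).
  rewrite rmorphM !rmorphXn rmorph_nat (valuationM vP) (valX vP m vp) (valX vP k E).
  by rewrite mulr1 -EFinD lee_fin leNgt kB.
have unit_eq0 y : cval y = 0%E -> v (sigma_hat i y) = 0%E.
  move=> y0; have yn0 := val_neq0 (cP (pl i)) y0.
  have y'0 : cval y^-1 = 0%E by apply: (valV0 (cP (pl i))).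
  apply: (val_unit_of vP (unit_ge0 _ y0) (unit_ge0 _ y'0)).
  by rewrite -rmorphM divff // rmorph1 (val_one vP).
have [->|x0] := eqVneq x 0; first by rewrite rmorph0 (val0 vP) (val0 (cP (pl i))).
have [z zE] := cval_int x0.
have pz : cval (p%:R ^ z : Fv (pl i)) = z%:~R%:E.
  by rewrite (valXz (cP (pl i)) z (p_unramified (pl i))) mulr1.
have pz0 : (p%:R ^ z : Fv (pl i)) != 0.
  by apply/eqP => E; move: pz; rewrite E (val0 (cP (pl i))).
have u0 : cval (x / p%:R ^ z) = 0%E.
  by rewrite (valuationM (cP (pl i))) (valV (cP (pl i)) pz) zE -EFinD subrr.
rewrite -[x in LHS](divfK pz0) rmorphM (valuationM vP) unit_eq0 // add0e zE.
by rewrite fmorphXz rmorph_nat (valXz vP z vp) mulr1.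
Qed.

(** The values of a character of finite order are roots of unity. *)
Lemma psi_unit x : Op_unit x -> v (psi x) = 0%E.
Proof.
move=> ux; have [psi0 _ _ [m m0 psim]] := psi_char.
have [e E] := val_real vP (psi0 _ ux).
have := valX vP m E; rewrite psim // (val_one vP) => -[/esym/eqP].
by rewrite mulf_eq0 pnatr_eq0 -[m == 0%N]leqn0 leqNgt m0 /= E => /eqP ->.
Qed.

(** The components at p of the elements of U_0(n p^s). *)
Definition iwahori g : Prop := forall q,
  [/\ forall i j, cint (g q i j),
      exists2 z, cint z & g q ord_max ord0 = p%:R ^+ s * z &
      cval (\det (g q)) = 0%E].

Lemma cint_ps q (z : Fv q) : cint z -> vge (@cval _ _ _ (Fv q)) 1 (p%:R ^+ s * z).
Proof.
move=> zO; apply: vgeW (_ : 1 <= s%:R + 0) _; first by rewrite addr0 ler1n.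
apply: (vgeM (cP q)) => //.
by rewrite /vge (valX (cP q) s (p_unramified q)) mulr1.
Qed.

Lemma iwahori_unit g q : iwahori g ->
  cval (g q ord0 ord0) = 0%E /\ cval (g q ord_max ord_max) = 0%E.
Proof.
move=> /(_ q)[gO [z zO cE] gdet].
(* The product bc is divisible by p, so ad is a unit along with det. *)
suff ad : cval (g q ord0 ord0 * g q ord_max ord_max) = 0%E.
  split; first exact: (val_unit_of (cP q) (gO _ _) (gO _ _) ad).
  by rewrite mulrC in ad; exact: (val_unit_of (cP q) (gO _ _) (gO _ _) ad).
have -> : g q ord0 ord0 * g q ord_max ord_max =
    \det (g q) + g q ord0 ord_max * g q ord_max ord0 by rewrite det_mx2 subrK.
apply: (valD_unit (cP q)) => //.
have : vge (@cval _ _ _ (Fv q)) 1 (g q ord0 ord_max * g q ord_max ord0).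
  by rewrite cE; apply: (vgeMl (cP q)); [exact: gO | exact: cint_ps].
by apply: lt_le_trans; rewrite lte_fin.
Qed.

Lemma iwahori_Op_unit g : iwahori g -> Op_unit (fun q => g q ord_max ord_max).
Proof. by move=> gI q; have [] := iwahori_unit q gI. Qed.

Definition entry i g (j k : 'I_2) : L := sigma_hat i (g (pl i) j k).

Lemma mono_actE g l m :
  mono_act sigma_hat n w psi g l m = psi (fun q => g q ord_max ord_max) *
  \prod_i (sigma_hat i (\det (g (pl i))) ^ (w i) *
    moebius (n i) (entry i g ord0 ord0) (entry i g ord0 ord_max)
      (entry i g ord_max ord0) (entry i g ord_max ord_max) (l i) (m i)).
Proof.
congr (_ * _); apply: eq_bigr => i _.
by rewrite /entry /moebius det_map_mx !mxE.
Qed.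

Section Iwahori.
Variables (g : forall q : pplace F p, 'M[Fv q]_2).
Hypothesis gI : iwahori g.

Lemma entry_int i j k : vge v 0 (entry i g j k).
Proof. by rewrite /vge val_sigma_hat; have [gO _ _] := gI (pl i); exact: gO. Qed.

Lemma entry_c i : vge v 1 (entry i g ord_max ord0).
Proof.
rewrite /vge val_sigma_hat; have [_ [z zO ->] _] := gI (pl i); exact: cint_ps.
Qed.

Lemma entry_d i : v (entry i g ord_max ord_max) = 0%E.
Proof. by rewrite val_sigma_hat; have [] := iwahori_unit (pl i) gI. Qed.

Lemma entry_det i : v (sigma_hat i (\det (g (pl i))) ^ (w i)) = 0%E.
Proof.
have [_ _ gdet] := gI (pl i); rewrite -val_sigma_hat in gdet.
by rewrite (valXz vP _ gdet) mulr0.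
Qed.

(** The factors psi(d) and det^w are units, so only the series contribute. *)
Lemma mono_act_ge (l m : multi) A (B : 'I_2 -> R) :
  (forall i, vge v (B i) (moebius (n i) (entry i g ord0 ord0) (entry i g ord0 ord_max)
      (entry i g ord_max ord0) (entry i g ord_max ord_max) (l i) (m i))) ->
  A <= \sum_i B i -> vge v A (mono_act sigma_hat n w psi g l m).
Proof.
move=> hB /vgeW; apply; rewrite mono_actE; apply: (vgeMl vP).
  by rewrite /vge (psi_unit (iwahori_Op_unit gI)).
apply: (vge_prod vP) => i _; apply: (vgeMl vP) => //.
by rewrite /vge entry_det.
Qed.

Lemma mono_act_int l m : vge v 0 (mono_act sigma_hat n w psi g l m).
Proof.
apply: (@mono_act_ge _ _ _ (fun => 0)); last by rewrite big1.
move=> i; apply: (moebius_int vP); rewrite ?entry_d //; exact: entry_int.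
Qed.

Lemma tate_mono_act l : tate v (mono_act sigma_hat n w psi g l).
Proof.
move=> A; pose N := (Num.truncn (A + \sum_i (l i)%:R)).+1.
apply: (sub_finite_set _ (finite_fset (multi_box N))) => m /=.
apply: contra_notP => mN.
have [i0 mi0] : exists i, (N <= m i)%N.
  apply: contrapT => h; apply: mN; apply/in_multi_boxP => i.
  by rewrite ltnNge; apply/negP => ?; apply: h; exists i.
apply: (@mono_act_ge _ _ _ (fun i => (m i)%:R * 1 - (l i)%:R * 1)).
  move=> i; apply: (growth_moebius vP); rewrite ?entry_d ?subrr //.
  - exact: entry_int.
  - by apply: vgeW (entry_int _ _ _); rewrite oppr_le0.
  - exact: entry_c.
under [X in _ <= X]eq_bigr do rewrite !mulr1.
rewrite sumrB lerBrDr.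
have := @truncnS_gt R (A + \sum_i (l i)%:R) => /ltW/le_trans; apply.
by rewrite [leRHS](bigD1 i0) //= ler_wpDr ?sumr_ge0 // ler_nat.
Qed.

End Iwahori.

Lemma iwahori_mul g g' : iwahori g -> iwahori g' -> iwahori (fun q => g q *m g' q).
Proof.
move=> gI gI' q; have [gO [z zO cE] gdet] := gI q; have [gO' [z' zO' cE'] gdet'] := gI' q.
have cD (x y : Fv q) : cint x -> cint y -> cint (x + y) by exact: (@vgeD _ _ _ (cP q) 0).
have cM (x y : Fv q) : cint x -> cint y -> cint (x * y) by exact: (@vgeMl _ _ _ (cP q) 0).
split=> [i j||].
- by rewrite mulmx2E; apply: cD; apply: cM.
- exists (z * g' q ord0 ord0 + g q ord_max ord_max * z').
    by apply: cD; apply: cM.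
  by rewrite mulmx2E cE cE'; ring.
- by rewrite det_mulmx; apply: (valM0 (cP q)).
Qed.

Lemma psi_mul g g' : iwahori g -> iwahori g' ->
  psi (fun q => (g q *m g' q) ord_max ord_max) =
  psi (fun q => g q ord_max ord_max) * psi (fun q => g' q ord_max ord_max).
Proof.
move=> gI gI'; have [_ psiM psi_cong _] := psi_char.
have dU := iwahori_Op_unit gI; have dU' := iwahori_Op_unit gI'.
rewrite -psiM //; apply: psi_cong.
- exact: iwahori_Op_unit (iwahori_mul gI gI').
- by move=> q; apply: (valM0 (cP q)); [exact: dU | exact: dU'].
- move=> q; have [_ [z zO cE] _] := gI q; have [gO' _ _] := gI' q.
  exists (z * g' q ord0 ord_max).
    by apply: (@vgeMl _ _ _ (cP q) 0) => //; exact: gO'.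
  by rewrite mulmx2E cE; ring.
Qed.

Lemma is_vsumZ (I : choiceType) (c : L) (f : I -> L) l :
  is_vsum v f l -> is_vsum v (fun i => c * f i) (c * l).
Proof.
have [-> _ A|c0 fl A] := eqVneq c 0.
  exists fset0 => J _; rewrite big1 => [|i _]; rewrite mul0r // subr0; exact: vge0.
have [e E] := val_real vP c0; have [K0 h] := fl (A - e); exists K0 => J /h hJ.
rewrite -mulr_sumr -mulrBr -[A](subrK e) addrC; apply: (vgeM vP) => //.
by rewrite /vge E.
Qed.

(** X^l . (g g') is the sum of the (X^l . g)_k (X^k . g'): the law of composition
    in each variable, multiplied over the variables. *)
Lemma mono_act_comp g g' l m : iwahori g -> iwahori g' ->
  is_vsum v (fun k => mono_act sigma_hat n w psi g l k * mono_act sigma_hat n w psi g' k m)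
    (mono_act sigma_hat n w psi (fun q => g q *m g' q) l m).
Proof.
move=> gI gI'.
pose d := fun q => g q ord_max ord_max; pose d' := fun q => g' q ord_max ord_max.
pose e i := sigma_hat i (\det (g (pl i))) ^ (w i).
pose e' i := sigma_hat i (\det (g' (pl i))) ^ (w i).
pose x i k := moebius (n i) (entry i g ord0 ord0) (entry i g ord0 ord_max)
      (entry i g ord_max ord0) (entry i g ord_max ord_max) (l i) k *
  moebius (n i) (entry i g' ord0 ord0) (entry i g' ord0 ord_max)
      (entry i g' ord_max ord0) (entry i g' ord_max ord_max) k (m i).
pose y i := moebius (n i)
  (entry i (fun q => g q *m g' q) ord0 ord0) (entry i (fun q => g q *m g' q) ord0 ord_max)
  (entry i (fun q => g q *m g' q) ord_max ord0) (entry i (fun q => g q *m g' q) ord_max ord_max)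
  (l i) (m i).
have -> : mono_act sigma_hat n w psi (fun q => g q *m g' q) l m =
    psi d * psi d' * (\prod_i (e i * e' i)) * \prod_i y i.
  rewrite mono_actE psi_mul // -/d -/d' -[RHS]mulrA -big_split; congr (_ * _).
  by apply: eq_bigr => i _; rewrite det_mulmx rmorphM expfzMl.
have -> : (fun k => mono_act sigma_hat n w psi g l k * mono_act sigma_hat n w psi g' k m) =
    (fun k => psi d * psi d' * (\prod_i (e i * e' i)) * \prod_i x i (k i)).
  apply/funext => k; rewrite !mono_actE -/d -/d' !big_split /= /e /e'; ring.
apply: is_vsumZ; apply: (is_vsum_prod vP) => i.
  move=> k; rewrite /x -[0]addr0; apply: (vgeM vP); apply: (moebius_int vP);
    rewrite ?entry_d //; exact: entry_int.
have entM j k : entry i (fun q => g q *m g' q) j k =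
    entry i g j ord0 * entry i g' ord0 k + entry i g j ord_max * entry i g' ord_max k.
  by rewrite /entry mulmx2E rmorphD !rmorphM.
rewrite /y !entM; apply: (@moebius_comp _ _ _ vP cL _ _ _ 1) => //;
  by [exact: entry_int | exact: entry_c | exact: entry_d].
Qed.

Lemma psi1 : psi (fun q => 1) = 1.
Proof.
have [psi0 psiM _ _] := psi_char.
have u1 : Op_unit (fun q => 1 : Fv q) by move=> q; rewrite (val_one (cP q)).
apply: (mulfI (psi0 _ u1)); rewrite mulr1 -psiM //; congr psi.
by apply: functional_extensionality_dep => q; rewrite mulr1.
Qed.

Lemma mono_act_one l m : mono_act sigma_hat n w psi (fun q => 1%:M) l m = (m == l)%:R.
Proof.
rewrite mono_actE (_ : (fun q => _) = (fun q => 1)) ?psi1 ?mul1r; last first.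
  by apply: functional_extensionality_dep => q; rewrite mxE eqxx.
have -> : \prod_i (sigma_hat i (\det (1%:M : 'M_2)) ^ (w i) *
    moebius (n i) (entry i (fun q => 1%:M) ord0 ord0) (entry i (fun q => 1%:M) ord0 ord_max)
      (entry i (fun q => 1%:M) ord_max ord0) (entry i (fun q => 1%:M) ord_max ord_max)
      (l i) (m i)) = \prod_i (m i == l i)%:R.
  apply: eq_bigr => i _.
  by rewrite /entry !mxE /= rmorph1 rmorph0 det1 rmorph1 exp1rz mul1r moebius1.
have [->|ml] := eqVneq m l; first by rewrite big1 // => i _; rewrite eqxx.
have [i mi] : exists i, m i != l i.
  apply: contrapT => h; case/eqP: ml; apply/ffunP => i; apply/eqP.
  by apply: contrapT => /negP ?; apply: h; exists i.
by rewrite (bigD1 i) //= (negbTE mi) mul0r.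
Qed.

Section Scalars.
Hypotheses (F2 : \dim {:F} = 2%N) (sigma_distinct : exists x, sigma ord0 x <> sigma ord_max x).
Hypothesis psi_units : forall x, unitOfInt x -> psi (Fp_diag Fv x) = (\prod_i sigma i x) ^ r.

(** A scalar c multiplies the action by psi(c) times the product of the
    sigma_i(c)^(n_i + 2 w_i), which is N(c)^(2 r). *)
Lemma mono_act_scalar c g l m : unitOfInt c -> iwahori g ->
  mono_act sigma_hat n w psi (fun q => cmap (Fv q) c *: g q) l m =
  mono_act sigma_hat n w psi g l m.
Proof.
move=> cU gI; have [c0 Oc Oc'] := cU; have [_ psiM _ _] := psi_char.
have sc0 i : sigma i c != 0 by rewrite fmorph_eq0.
rewrite !mono_actE.
have -> : psi (fun q => (cmap (Fv q) c *: g q) ord_max ord_max) =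
    (\prod_i sigma i c) ^ r * psi (fun q => g q ord_max ord_max).
  rewrite -psi_units // -psiM; last exact: iwahori_Op_unit.
    by congr psi; apply: functional_extensionality_dep => q; rewrite mxE.
  move=> q; have h := val_unit_of (cP q) (cval_ge0 (Fv q) Oc) (cval_ge0 (Fv q) Oc').
  by apply: h; rewrite -rmorphM divff // rmorph1 (val_one (cP q)).
have -> : \prod_i (sigma_hat i (\det (cmap (Fv (pl i)) c *: g (pl i))) ^ w i *
    moebius (n i) (entry i (fun q => cmap (Fv q) c *: g q) ord0 ord0)
      (entry i (fun q => cmap (Fv q) c *: g q) ord0 ord_max)
      (entry i (fun q => cmap (Fv q) c *: g q) ord_max ord0)
      (entry i (fun q => cmap (Fv q) c *: g q) ord_max ord_max) (l i) (m i)) =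
  (\prod_i sigma i c) ^ r * \prod_i (sigma_hat i (\det (g (pl i))) ^ w i *
    moebius (n i) (entry i g ord0 ord0) (entry i g ord0 ord_max)
      (entry i g ord_max ord0) (entry i g ord_max ord_max) (l i) (m i)).
  have -> : (\prod_i sigma i c) ^ r = \prod_i (sigma i c) ^ r.
    by rewrite !(big_ord_recl, big_ord0) !mulr1 expfzMl.
  rewrite -big_split; apply: eq_bigr => i _ /=.
  have entZ j k : entry i (fun q => cmap (Fv q) c *: g q) j k = sigma i c * entry i g j k.
    by rewrite /entry mxE rmorphM /= (sigma_ext i).1.
  rewrite !entZ moebiusZ // detZ rmorphM rmorphXn (sigma_ext i).1 expfzMl.
  rewrite -(weight i) expfzDr // -exprz_exp; ring.
rewrite mulrACA.
have -> : (\prod_i sigma i c) ^ r * (\prod_i sigma i c) ^ r = 1.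
  by rewrite -expfzMl -expr2 norm_unit_sqr // exp1rz.
by rewrite mul1r.
Qed.

End Scalars.

(** The bound for a form to which the operators U_q, for q in [S], have been
    applied, before normalisation. *)
Definition bounded_at (S : seq (pplace F p)) (f : multi -> L) : Prop :=
  forall m : multi, vge v (\sum_(i | pl i \in S) ((w i)%:~R + (m i)%:R)) (f m).

(** The determinant pi gives the valuation w_i, and the entries pi and
    alpha pi^s, both divisible by p, give the valuation m_i. The variables
    attached to the other places see the identity matrix. *)
Lemma weight_act_hecke S q0 (pi alpha : Fv q0) g f :
  cval pi = 1%:E -> cint alpha -> q0 \notin S ->
  g q0 = mx2 pi 0 (alpha * pi ^+ s) 1 -> (forall q, q != q0 -> g q = 1%:M) ->
  bounded_at S f -> bounded_at (q0 :: S) (weight_act v sigma_hat n w psi f g).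
Proof.
move=> pi1 alphaO q0S gq0 gq fS m; apply: vsum_ge => // l.
(* B i is the gain in the variable X_i when passing from the exponents l to m. *)
pose C i (k : nat) : R := if pl i \in S then (w i)%:~R + k%:R else 0.
pose B i : R := if pl i == q0 then (w i)%:~R + (m i)%:R else C i (m i) - C i (l i).
have -> : \sum_(i | pl i \in q0 :: S) ((w i)%:~R + (m i)%:R) =
    \sum_(i | pl i \in S) ((w i)%:~R + (l i)%:R) + \sum_i B i :> R.
  rewrite !(big_mkcond (fun i => pl i \in _)) -big_split; apply: eq_bigr => i _ /=.
  rewrite inE /B /C; case: eqP => [->|_] /=; first by rewrite (negbTE q0S) add0r.
  by case: ifP => _; ring.
apply: (vgeM vP) => //; rewrite mono_actE; apply: (vgeMl vP).
  rewrite (_ : (fun q => _) = (fun q => 1)) ?psi1; first exact: vge1.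
  apply: functional_extensionality_dep => q.
  have [->|/gq ->] := eqVneq q q0; last by rewrite mxE eqxx.
  by rewrite gq0 mxE /= .
apply: (vge_prod vP) => i _; rewrite /B; case: eqP => [piE|/eqP pine].
  rewrite {}/B {}/C {gq fS}; subst q0.
  have piL : v (sigma_hat i pi) = 1%:E by rewrite val_sigma_hat.
  have detE : \det (g (pl i)) = pi by rewrite gq0 det_mx2 !mxE /=; ring.
  apply: (vgeM vP); first by rewrite detE /vge (valXz vP _ piL) mulr1.
  have := @growth_moebius _ _ _ vP 1 0 (n i) (entry i g ord0 ord0) (entry i g ord0 ord_max)
    (entry i g ord_max ord0) (entry i g ord_max ord_max) (l i).
  rewrite /entry gq0 !mxE /= rmorph0 rmorph1 !mulr0 => h.
  have := h _ _ _ _ (m i); rewrite mulr1 !subr0; apply.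
  - by rewrite /vge piL.
  - exact: vge0.
  - rewrite rmorphM /=; apply: (vgeMl vP).
      by rewrite /vge val_sigma_hat.
    by rewrite rmorphXn /vge (valX vP _ piL) mulr1 lee_fin ler1n.
  - exact: (val_one vP).
have -> : sigma_hat i (\det (g (pl i))) ^ w i *
    moebius (n i) (entry i g ord0 ord0) (entry i g ord0 ord_max)
     (entry i g ord_max ord0) (entry i g ord_max ord_max) (l i) (m i) = (m i == l i)%:R.
  rewrite /entry gq //; rewrite !mxE /= rmorph1 rmorph0 det1 rmorph1 exp1rz mul1r.
  exact: moebius1.
have [->|_] := eqVneq (m i) (l i); last exact: vge0.
by rewrite subrr; exact: vge1.
Qed.

End LocalAction.

(** * The level and its double cosets *)

Section LocalIdeal.
Variables (R : realType) (F : fieldExtType rat) (q : place F) (Fq : completion R q).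
Implicit Types (I : set F) (x y : Fq).

Let qP := cval_valuation Fq.

Lemma cintD x y : cint x -> cint y -> cint (x + y).
Proof. exact: (@vgeD _ _ _ qP 0). Qed.

Lemma cintN x : cint x -> cint (- x).
Proof. by rewrite /cint /= (valN qP). Qed.

Lemma local_idealD I x y : local_ideal I x -> local_ideal I y -> local_ideal I (x + y).
Proof.
move=> [a aP ->] [b bP ->]; exists (a ++ b); last by rewrite big_cat.
by move=> k; rewrite mem_cat => /orP[/aP|/bP].
Qed.

Lemma local_idealM I x y : cint x -> local_ideal I y -> local_ideal I (x * y).
Proof.
move=> xO [a aP ->]; exists [seq (x * k.1, k.2) | k <- a].
  move=> _ /mapP[k /aP[k1 k2] ->]; split=> //=.
  exact: (@vgeMl _ _ _ qP 0).
by rewrite big_map mulr_sumr; apply: eq_bigr => k _; rewrite mulrA.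
Qed.

Lemma local_ideal0 I : local_ideal I (0 : Fq).
Proof. by exists [::]; rewrite ?big_nil. Qed.

Lemma local_ideal_multiple (I : set F) (c : nat) x : I `<=` @ringOfInt F ->
  local_ideal [set c%:R * y | y in I] x -> exists2 z : Fq, cint z & x = c%:R * z.
Proof.
move=> IO [a aP ->]; elim: a aP => [_|k a IH aP].
  by exists 0; rewrite ?big_nil ?mulr0 //; exact: (@vge0 _ _ _ qP 0).
have [z zO zE] := IH (fun k' ka => aP k' (mem_behead (s := k :: a) ka)).
have [kO [y Iy yE]] := aP k (mem_head _ _).
exists (k.1 * cmap Fq y + z).
  apply: cintD => //; apply: (@vgeMl _ _ _ qP 0) => //.
  by apply: cval_ge0; exact: IO.
rewrite big_cons zE -yE rmorphM rmorph_nat; ring.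
Qed.

End LocalIdeal.

Section Adelic.
Variables (R : realType) (F : fieldExtType rat).
Variable Fv : forall q : place F, completion R q.
Variables (a b : F) (OD : max_order a b).
Implicit Types (q : place F) (d : quat a b).

Let cP (q : place F) : is_valuation (@cval _ _ _ (Fv q)) := cval_valuation (Fv q).

Lemma DmapM q d d' : Dmap Fv q (d * d') = Dmap Fv q d * Dmap Fv q d'.
Proof. exact: quat_mapM. Qed.

Lemma Dmap1 q : Dmap Fv q (1 : quat a b) = 1.
Proof. exact: quat_map1. Qed.

Lemma Dmap_const q c : Dmap Fv q (quat_const a b c) = cmap (Fv q) c *: (1 : Dloc a b Fv q).
Proof.
rewrite -[RHS]/(quat_scale _ (quat_one _ _)) /Dmap /quat_map /quat_scale /=.
by rewrite rmorph0 mulr1 mulr0.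
Qed.

Lemma scale1_mul q (c : Fv q) (x : Dloc a b Fv q) : (c *: (1 : Dloc a b Fv q)) * x = c *: x.
Proof.
rewrite -[LHS]/(quat_mul (quat_scale c (quat_one _ _)) x) -[RHS]/(quat_scale c x).
by case: x => x0 x1 x2 x3; rewrite /quat_mul /quat_scale /=; congr Quat; ring.
Qed.

Lemma scale1_mulr q (c : Fv q) (x : Dloc a b Fv q) : x * (c *: (1 : Dloc a b Fv q)) = c *: x.
Proof.
rewrite -[LHS]/(quat_mul x (quat_scale c (quat_one _ _))) -[RHS]/(quat_scale c x).
by case: x => x0 x1 x2 x3; rewrite /quat_mul /quat_scale /=; congr Quat; ring.
Qed.

Lemma q0_scale (q : place F) (c : Fv q) (x : Dloc a b Fv q) : q0 (c *: x) = c * q0 x.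
Proof. by case: x. Qed.

Lemma q0_sum (q : place F) I (r : seq I) (f : I -> Dloc a b Fv q) :
  q0 (\sum_(k <- r) f k) = \sum_(k <- r) q0 (f k).
Proof. by elim: r => [|k r IH]; rewrite ?big_nil // !big_cons -IH; case: (f k). Qed.

(** An order is contained in a finitely generated module, hence is bounded. *)
Lemma Oloc_bounded q : exists B : R, forall x : Dloc a b Fv q, Oloc OD x ->
  vge (@cval _ _ _ (Fv q)) B (q0 x).
Proof.
have [_ _ [N [e [_ eP]]] _] := order_order OD.
have has_vge (y : Fv q) : exists B : R, vge (@cval _ _ _ (Fv q)) B y.
  have [->|y0] := eqVneq y 0; first by exists 0; apply: (vge0 (cP q)).
  by have [B E] := val_real (cP q) y0; exists B; rewrite /vge E.
have /choice[B hB] : forall k : 'I_N, exists B : R,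
    vge (@cval _ _ _ (Fv q)) B (cmap (Fv q) (q0 (e k))) by move=> k; exact: has_vge.
(* A lower bound common to the coordinates of all the generators. *)
pose B0 := - \sum_k `|B k|.
have hB0 k : vge (@cval _ _ _ (Fv q)) B0 (cmap (Fv q) (q0 (e k))).
  apply: vgeW (hB k); rewrite /B0 lerNl (bigD1 k) //=.
  by rewrite ler_wpDr ?sumr_ge0 // -normrN ler_norm.
exists B0 => x [s sP ->]; rewrite q0_sum; apply: (vge_sum_seq (cP q)) => k /sP[kO kD].
rewrite q0_scale; apply: (vgeMl (cP q)) => //.
have [c cO ->] := eP _ kD.
have -> : q0 (Dmap Fv q (\sum_i c i *: e i)) = \sum_i cmap (Fv q) (c i) * cmap (Fv q) (q0 (e i)).
  rewrite /Dmap /quat_map /=.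
  have -> : q0 (\sum_i c i *: e i) = \sum_i c i * q0 (e i).
    by elim/big_rec2: _ => // i y z _ <-; case: (e i) => ? ? ? ?; case: z.
  by rewrite rmorph_sum; apply: eq_bigr => i _; rewrite rmorphM.
apply: (vge_sum (cP q)) => i _; apply: (vgeMl (cP q)) => //; exact: cval_ge0.
Qed.

(** The powers of a scalar of an order stay bounded. This needs no splitting at
    q, and so applies at the primes away from n p. *)
Lemma Oloc_scalar q (c : Fv q) : Oloc OD (c *: (1 : Dloc a b Fv q)) ->
  vge (@cval _ _ _ (Fv q)) 0 c.
Proof.
move=> cO; have [B hB] := Oloc_bounded q.
have [->|c0] := eqVneq c 0; first exact: (vge0 (cP q)).
have [e E] : exists e : R, cval c = e%:E := val_real (cP q) c0.
have cX k : Oloc OD (c ^+ k *: (1 : Dloc a b Fv q)).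
  elim: k => [|k IH]; first by rewrite expr0 scale1r; exact: Oloc1.
  by rewrite exprS -scalerA -scale1_mul; apply: OlocM.
rewrite /vge E lee_fin leNgt; apply/negP => e0.
have := hB _ (cX (Num.truncn (B / e)).+1); rewrite q0_scale mulr1 /vge.
rewrite (valX (cP q) _ E) lee_fin leNgt => /negP; apply.
by rewrite -ltr_ndivrMr //; apply: truncnS_gt.
Qed.

Variables (p : nat) (n : set F) (s : nat).
Hypotheses (n_ideal : is_ideal n).
Variable theta : forall q : place F, {rmorphism Dloc a b Fv q -> 'M[Fv q]_2}.
Hypothesis theta_split : forall q : place F, divides q [set p%:R * x | x in n] ->
     is_splitting OD (theta q).
Let U : set (Dfx Fv OD) := U0 theta n p s.

Lemma divides_p (q : pplace F p) : divides q [set p%:R * x | x in n].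
Proof.
move=> _ [x nx <-]; have [[_ _ _ qM] _ _] := place_prime (place_of q).
rewrite mulrC; apply: qM; first by have [nO _ _ _] := n_ideal; exact: nO.
by have /asboolP := valP q.
Qed.

Lemma U0_one : U 1%g.
Proof.
move=> q; split; [exact: Oloc1 | rewrite /= invr1; exact: Oloc1 |].
by move=> _ /=; rewrite rmorph1 mxE /=; exact: local_ideal0.
Qed.

Lemma U0_mul u w : U u -> U w -> U (u * w)%g.
Proof.
move=> uU wU q; have [uO uO' uc] := uU q; have [wO wO' wc] := wU q.
have [uu _ _] := dfxP u; have [ww _ _] := dfxP w.
split=> [||qn]; first exact: OlocM.
  by rewrite /= invrM ?uu ?ww //; exact: OlocM.
have [_ _ th] := theta_split qn; move/th: (uO) => tu; move/th: (wO) => tw.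
rewrite /= rmorphM /= mulmx2E; apply: local_idealD; last first.
  by apply: local_idealM; [exact: tu | exact: wc].
by rewrite mulrC; apply: local_idealM; [exact: tw | exact: uc].
Qed.

Lemma theta_inv (u : Dfx Fv OD) q : theta q ((u^-1)%g q) *m theta q (u q) = 1%:M.
Proof.
by have [uu _ _] := dfxP u; rewrite mulmxE -rmorphM /= mulVr ?uu // rmorph1.
Qed.

(** The entry below the diagonal of the inverse is a multiple of the entry c of
    the matrix itself, by Cramer's rule. *)
Lemma U0_inv u : U u -> U u^-1%g.
Proof.
move=> uU q; have [uO uO' uc] := uU q; have [uu _ _] := dfxP u.
split=> [||qn]; [exact: uO' | by rewrite /= invrK |].
have [_ _ th] := theta_split qn; move/th: (uO) => tu; move/th: (uO') => tu'.
have E := theta_inv u q.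
set A := theta q ((u^-1)%g q) in E *; set B := theta q (u q) in E tu.
have detAB : \det A * \det B = 1 by rewrite -det_mulmx E det1.
have A10 : A ord_max ord0 * B ord0 ord0 = - (A ord_max ord_max * B ord_max ord0).
  have := congr1 (fun M : 'M_2 => M ord_max ord0) E; rewrite /= mulmx2E mxE /=.
  by move/eqP; rewrite addr_eq0 => /eqP.
have -> : A ord_max ord0 = - (A ord_max ord_max * B ord_max ord_max
     + A ord_max ord0 * B ord0 ord_max) * \det A * B ord_max ord0.
  rewrite -[LHS]mulr1 -detAB [\det B]det_mx2.
  transitivity (((A ord_max ord0 * B ord0 ord0) * B ord_max ord_max
     - A ord_max ord0 * B ord0 ord_max * B ord_max ord0) * \det A); first by ring.
  by rewrite A10; ring.
apply: local_idealM; last exact: uc.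
apply: cintM; first by apply: cintN; apply: cintD; apply: cintM; [exact: tu'|exact: tu|exact: tu'|exact: tu].
rewrite det_mx2; apply: cintD; first by apply: cintM; exact: tu'.
by apply: cintN; apply: cintM; exact: tu'.
Qed.

Lemma iwahori_at_p u : U u -> iwahori s (@at_p _ _ p _ _ _ _ theta u).
Proof.
move=> uU q; have [uO uO' uc] := uU q.
have [_ _ th] := theta_split (divides_p q); move/th: (uO) => tu; move/th: (uO') => tu'.
split=> [//||].
  have := uc (divides_p q); rewrite -natrX => /local_ideal_multiple[].
    by have [] := n_ideal.
  by move=> z zO zE; exists z => //; rewrite -natrX.
have detO (A : 'M[Fv q]_2) : (forall i j, cint (A i j)) -> vge (@cval _ _ _ (Fv q)) 0 (\det A).
  move=> AO; rewrite det_mx2; apply: cintD; first by apply: cintM; exact: AO.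
  by apply: cintN; apply: cintM; exact: AO.
apply: (val_unit_of (cP q) (detO _ tu) (detO _ tu')).
rewrite mulrC -det_mulmx.
by have := theta_inv u q; rewrite /= => ->; rewrite det1 (val_one (cP q)).
Qed.

Lemma at_p_mul (u w : Dfx Fv OD) : @at_p _ _ p _ _ _ _ theta (u * w)%g =
  fun q : pplace F p => at_p theta u q *m at_p theta w q.
Proof. by apply: functional_extensionality_dep => q; rewrite /at_p /= rmorphM. Qed.

Lemma at_p_one : @at_p _ _ p _ _ _ _ theta (1%g : Dfx Fv OD) = fun q : pplace F p => 1%:M.
Proof. by apply: functional_extensionality_dep => q; rewrite /at_p /= rmorph1. Qed.

Hypothesis F2 : \dim {:F} = 2%N.
Variables (h' : nat) (t : 'I_h' -> Dfx Fv OD).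
Hypothesis U_small : sufficiently_small U t.

(** Comparing the two decompositions gives an element of D in t U t^-1, which is a
    scalar c since the level is sufficiently small. Both c and its inverse lie in
    all local orders. *)
Lemma double_coset_unit i d d' w w' g : U w -> U w' ->
  rat_mul d (t i * w)%g g -> rat_mul d' (t i * w')%g g ->
  exists2 c, unitOfInt c & forall q, w' q = cmap (Fv q) c *: w q.
Proof.
move=> wU wU' [du dE] [du' dE'].
have [tu _ _] := dfxP (t i); have [wu _ _] := dfxP w; have [wu' _ _] := dfxP w'.
have E q : Dmap Fv q (d'^-1 * d) * (t i q * w q) = t i q * w' q.
  rewrite DmapM -mulrA -[Dmap Fv q d * _]dE dE' /= mulrA -DmapM mulVr // Dmap1 mul1r //.
have [c cE] : exists c : F, d'^-1 * d = quat_const a b c.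
  apply: (U_small (i := i)); split; first by rewrite unitrMr ?unitrV.
  exists (w' * w^-1)%g; first exact: U0_mul (U0_inv _).
  move=> q /=; rewrite mulrA -E !mulrA mulrK ?wu // mulrK ?tu //.
have wE q : w' q = cmap (Fv q) c *: w q.
  have := E q; rewrite cE Dmap_const scale1_mul => {}E.
  apply: (mulrI (tu q)); rewrite -E -[LHS]scale1_mulr -[_ *: w q]scale1_mulr.
  by rewrite mulrA.
exists c => //.
have c0 : c != 0.
  apply/eqP => c0; have : d'^-1 * d \is a GRing.unit by rewrite unitrMr ?unitrV.
  by rewrite cE c0 unitr0.
have wO q : Oloc OD (cmap (Fv q) c *: (1 : Dloc a b Fv q)).
  have [xO _ _] := U0_mul wU' (U0_inv wU) q; move: xO => /=.
  by rewrite wE -scale1_mul mulrK ?wu.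
have wO' q : Oloc OD (cmap (Fv q) c^-1 *: (1 : Dloc a b Fv q)).
  have [xO _ _] := U0_mul wU (U0_inv wU') q; move: xO => /=.
  have -> : w q = cmap (Fv q) c^-1 *: w' q.
    by rewrite wE scalerA -rmorphM mulVf // rmorph1 scale1r.
  by rewrite -scale1_mul mulrK ?wu'.
by split=> //; apply: (ringOfInt_local F2) => q; apply: Oloc_scalar.
Qed.

End Adelic.

(** * Overconvergent forms *)

Section Forms.
Variables (R : realType) (F : fieldExtType rat).
Variable Fv : forall q : place F, completion R q.
Variables (p : nat) (a b : F) (OD : max_order a b) (n : set F) (s : nat).
Hypotheses (p_unramified : unramified Fv p) (F2 : \dim {:F} = 2%N).
Hypotheses (n_ideal : is_ideal n) (s_ge1 : (1 <= s)%N).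
Variable theta : forall q : place F, {rmorphism Dloc a b Fv q -> 'M[Fv q]_2}.
Hypothesis theta_split : forall q : place F, divides q [set p%:R * x | x in n] ->
  is_splitting OD (theta q).
Let U : set (Dfx Fv OD) := U0 theta n p s.
Variables (h' : nat) (t : 'I_h' -> Dfx Fv OD).
Hypotheses (t_reps : double_coset_reps U t) (U_small : sufficiently_small U t).

Let U0_divg u w : U u -> U w -> U (u * w^-1)%g.
Proof. by move=> uU wU; apply: U0_mul => //; apply: U0_inv. Qed.

Lemma rat_mulM d (g g' u : Dfx Fv OD) : rat_mul d g g' -> rat_mul d (g * u)%g (g' * u)%g.
Proof. by case=> du E; split=> // q; rewrite /= E mulrA. Qed.

Lemma rat_mul_trans d d' (g g' g'' : Dfx Fv OD) :
  rat_mul d g g' -> rat_mul d' g' g'' -> rat_mul (d' * d) g g''.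
Proof.
case=> du E [du' E']; split=> [|q]; first by rewrite unitrMr.
by rewrite E' E DmapM mulrA.
Qed.

Lemma rat_mul_sym d (g g' : Dfx Fv OD) : rat_mul d g g' -> rat_mul d^-1 g' g.
Proof.
case=> du E; split=> [|q]; first by rewrite unitrV.
by rewrite E mulrA -DmapM mulVr // Dmap1 mul1r.
Qed.

Lemma rat_mul_1 (g : Dfx Fv OD) : rat_mul (1 : quat a b) g g.
Proof. by split=> [|q]; rewrite ?unitr1 // Dmap1 mul1r. Qed.

(** [w] is a possible component in U of [g], as an element of the double coset of
    [t j]. *)
Definition coset_part (j : 'I_h') (g w : Dfx Fv OD) : Prop :=
  U w /\ exists d, rat_mul d (t j * w)%g g.

Lemma coset_part_mul j g w u : U u -> coset_part j g w <-> coset_part j (g * u)%g (w * u)%g.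
Proof.
move=> uU; split=> -[wU [d E]].
  split; first exact: U0_mul.
  by exists d; rewrite mulgA; exact: rat_mulM.
split; first by rewrite -[w](mulgK u); exact: U0_divg.
exists d; have := rat_mulM u^-1%g E.
by rewrite mulgA !mulgK.
Qed.

Lemma coset_part_rat_mul j d g g' w : rat_mul d g g' -> coset_part j g w <-> coset_part j g' w.
Proof.
move=> dE; split=> -[wU [d' E]]; split=> //.
  by exists (d * d'); apply: rat_mul_trans dE.
by exists (d^-1 * d'); apply: rat_mul_trans (rat_mul_sym dE).
Qed.

Lemma coset_part_ex g : exists j w, coset_part j g w.
Proof. by have [j [d [u [uU E]]]] := t_reps.1 g; exists j, u; split=> //; exists d. Qed.

Lemma coset_part_t i j w : coset_part j (t i) w -> j = i.
Proof.
move=> [wU [d E]]; apply: (t_reps.2 j i (t i)); first by exists d, w.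
by exists 1, 1%g; split; [exact: U0_one | rewrite mulg1; exact: rat_mul_1].
Qed.

Lemma coset_part_t1 i : coset_part i (t i) 1%g.
Proof. by split; [exact: U0_one | exists 1; rewrite mulg1; exact: rat_mul_1]. Qed.

(** Evaluation at the t_i is injective on these forms, and the indicator functions
    of the double cosets show that it is surjective. *)
Lemma dim_S2 (L : fieldType) h : has_dim (S2 (L := L) U) h -> h = h'.
Proof.
move=> [e [eS ebasis]].
pose E : 'M[L]_(h, h') := \matrix_(k, i) e k (t i).
have ext f f' : S2 (L := L) U f -> S2 (L := L) U f' -> (forall i, f (t i) = f' (t i)) -> f = f'.
  move=> [fl fr] [fl' fr'] ff; apply/funext => g.
  have [j [w [wU [d dE]]]] := coset_part_ex g.
  by rewrite (fl _ _ _ dE) (fl' _ _ _ dE) fr // fr'.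
have sumE (c : 'I_h -> L) g : (\sum_k c k *: e k) g = \sum_k c k * e k g.
  by elim/big_ind2: _ => // ? ? ? ? <- <-.
have S2sum (c : 'I_h -> L) : S2 (L := L) U (\sum_k c k *: e k).
  split=> [d g g' dE|g u uU]; rewrite !sumE; apply: eq_bigr => k _.
    by have [el _] := eS k; rewrite (el _ _ _ dE).
  by have [_ er] := eS k; rewrite er.
have free : row_free E.
  apply: inj_row_free => c cE.
  have c0 : \sum_k c 0 k *: e k = 0.
    apply: ext => [||i]; [exact: S2sum | by split |].
    have := congr1 (fun A : 'rV_h' => A 0 i) cE; rewrite !mxE => cEi.
    by rewrite sumE -[RHS]cEi; apply: eq_bigr => k _; rewrite mxE.
  have S0 : S2 (L := L) U 0 by split.
  have [c' [_ uniq_c']] := ebasis 0 S0; apply/rowP => k; rewrite mxE.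
  have E1 : c' = (fun=> 0) by apply: uniq_c'; rewrite big1 // => i _; rewrite scale0r.
  have E2 : c' = (fun i => c 0 i) by apply: uniq_c'; rewrite c0.
  by have := congr1 (fun u => u k) E2; rewrite E1.
have full : row_full E.
  pose f i : Dfx Fv OD -> L^o := fun g => (`[< exists w, coset_part i g w >])%:R.
  have fS i : S2 (L := L) U (f i).
    split=> [d g g' dE|g u uU]; rewrite /f; congr (_%:R); congr nat_of_bool; apply: asbool_equiv_eq.
      by split=> -[w gw]; exists w; apply/(coset_part_rat_mul _ _ dE).
    split=> -[w gw]; last by exists (w * u)%g; exact: ((coset_part_mul i g w uU).1 gw).
    by exists (w * u^-1)%g; apply: (coset_part_mul i g _ uU).2; rewrite mulgVK.
  have /choice[c cE] : forall i, exists c : 'I_h -> L, f i = \sum_k c k *: e k.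
    by move=> i; have [c [? _]] := ebasis _ (fS i); exists c.
  apply/row_fullP; exists (\matrix_(i, k) c i k); apply/matrixP => i j; rewrite !mxE.
  have -> : (i == j)%:R = f i (t j).
    rewrite /f; congr (_%:R); congr nat_of_bool; apply/eqP/asboolP => [->|[w /coset_part_t]] //.
    by exists 1%g; exact: coset_part_t1.
  by rewrite cE sumE; apply: eq_bigr => k _; rewrite !mxE.
by rewrite -[LHS](eqP free); exact/eqP.
Qed.

Variables (L : fieldType) (v : L -> \bar R).
Hypotheses (vP : is_valuation v) (cL : is_complete v) (vp : v p%:R = 1%:E).
Variables (pl : 'I_2 -> pplace F p) (sigma : 'I_2 -> {rmorphism F -> L}).
Variable sigma_hat : forall i, {rmorphism Fv (pl i) -> L}.
Hypothesis sigma_ext : forall i, is_extension v (sigma i) (sigma_hat i).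
Hypothesis sigma_distinct : exists x, sigma ord0 x <> sigma ord_max x.
Variables (wn wv : 'I_2 -> int) (r : int) (psi : Fp p Fv -> L).
Hypotheses (weight : forall i, wn i + 2 * wv i = r) (psi_char : is_character s psi).
Hypothesis psi_units : forall x, unitOfInt x -> psi (Fp_diag Fv x) = (\prod_i sigma i x) ^ r.

Let iw w : U w -> iwahori s (@at_p _ _ p _ _ _ _ theta w) := iwahori_at_p n_ideal theta_split (u := w).
Let act g := mono_act sigma_hat wn wv psi g.
Let S := overconvergent v sigma_hat wn wv psi theta U.

(** Two components in U differ by a unit of F, which acts trivially. *)
Lemma act_coset_part j g w w' l : coset_part j g w -> coset_part j g w' ->
  act (at_p theta w) l = act (at_p theta w') l.
Proof.
move=> [wU [d dE]] [wU' [d' dE']].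
have [c cU wE] := double_coset_unit theta_split F2 U_small wU wU' dE dE'.
apply/funext => m; rewrite /act.
rewrite -(mono_act_scalar p_unramified sigma_ext weight s_ge1 psi_char F2 sigma_distinct
  psi_units l m cU (iw wU)).
congr (mono_act _ _ _ _ _ l m); apply: functional_extensionality_dep => q.
rewrite /at_p wE; have [_ thZ _] := theta_split (divides_p n_ideal q).
by rewrite thZ.
Qed.

(** The form with the value X^l at t_j and 0 at the other t_i: the functional
    equation forces the value X^l . w at d t_j w. *)
Definition basis_form (j : 'I_h') (l : multi) : Dfx Fv OD -> multi -> L := fun g =>
  if pselect (exists w, coset_part j g w) is left H then act (at_p theta (projT1 (cid H))) l
  else fun=> 0.

Lemma basis_formE j l g w : coset_part j g w -> basis_form j l g = act (at_p theta w) l.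
Proof.
move=> gw; rewrite /basis_form; case: pselect => [H|[]]; last by exists w.
by apply: act_coset_part gw; case: cid.
Qed.

Lemma basis_form0 j l g : ~ (exists w, coset_part j g w) -> basis_form j l g = fun=> 0.
Proof. by move=> gw; rewrite /basis_form; case: pselect. Qed.

Lemma basis_form_t j l i m : basis_form j l (t i) m = ((i, m) == (j, l))%:R.
Proof.
have [->|ij] := eqVneq i j.
  rewrite (basis_formE _ (coset_part_t1 j)) at_p_one /act (mono_act_one _ _ _ psi_char).
  by rewrite xpair_eqE eqxx.
rewrite basis_form0 ?xpair_eqE ?(negbTE ij) // => -[w /coset_part_t ji].
by rewrite ji eqxx in ij.
Qed.

Lemma basis_form_S j l : S (basis_form j l).
Proof.
split=> [g|d g g' dE|g u uU].
- have [[w gw]|ng] := pselect (exists w, coset_part j g w).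
    rewrite (basis_formE _ gw); have [wU _] := gw.
    exact: (tate_mono_act p_unramified vP vp sigma_ext wn wv s_ge1 psi_char (iw wU)).
  rewrite basis_form0 // => A; apply: (sub_finite_set _ (finite_set0 _)) => m /=.
  by case; exact: (vge0 vP).
- have [[w gw]|ng] := pselect (exists w, coset_part j g w).
    rewrite (basis_formE _ gw); apply: basis_formE.
    exact/(coset_part_rat_mul _ _ dE).
  rewrite !basis_form0 // => -[w gw]; apply: ng; exists w.
  exact/(coset_part_rat_mul _ _ dE).
- have [[w gw]|ng] := pselect (exists w, coset_part j g w).
    have gw' : coset_part j (g * u^-1)%g (w * u^-1)%g.
      by have uV : U u^-1%g := U0_inv theta_split uU; exact: ((coset_part_mul j g w uV).1 gw).
    rewrite (basis_formE _ gw) (basis_formE _ gw'); apply/funext => m.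
    rewrite /weight_act; apply: (vsumE vP); rewrite /act.
    have := mono_act_comp p_unramified vP cL vp sigma_ext wn wv s_ge1 psi_char l m
      (iw gw'.1) (iw uU).
    by rewrite -at_p_mul mulgVK.
  rewrite !basis_form0 //; last first.
    move=> [w gw]; apply: ng; exists (w * u)%g.
    by have := (coset_part_mul j _ w uU).1 gw; rewrite mulgVK.
  by apply/funext => m; apply: (vsum0 vP) => l'; rewrite mul0r.
Qed.

(** The action of U preserves integrality. *)
Lemma overconvergent_int f : S f -> (forall i m, vge v 0 (f (t i) m)) ->
  forall g m, vge v 0 (f g m).
Proof.
move=> [_ fl fr] ft g m; have [j [w [wU [d dE]]]] := coset_part_ex g.
rewrite (fl _ _ _ dE) -(fr _ _ wU) mulgK; apply: (vsum_ge vP) => l.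
rewrite -[0]addr0; apply: (vgeM vP) => //.
exact: (mono_act_int p_unramified vP vp sigma_ext wn wv s_ge1 psi_char (iw wU)).
Qed.

Variables (pi : forall q : pplace F p, Fv q).
Hypothesis pi_unif : forall q, cval (pi q) = 1%:E.

(** The element exists since the local algebra at q is a matrix algebra. *)
Lemma hecke_eltP (q : pplace F p) (alpha : Fv q) :
  theta q (hecke_elt OD theta s pi alpha q) = mx2 (pi q) 0 (alpha * pi q ^+ s) 1 /\
  forall q' : place F, q' <> q -> hecke_elt OD theta s pi alpha q' = 1.
Proof.
pose A := mx2 (pi q) 0 (alpha * pi q ^+ s) 1.
have pi0 : pi q != 0.
  apply/eqP => E; have := pi_unif q; rewrite E.
  by have [/(_ 0) [_ ->]] := cval_valuation (Fv q).
have Au : A \in unitmx.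
  by rewrite unitmxE det_mx2 !mxE /= mulr1 mul0r subr0 unitfE.
have [bij _ _] := theta_split (divides_p n_ideal q).
have [thi thK thK'] := bij.
have th_inj := bij_inj bij.
pose x := thi A.
have xu : x \is a GRing.unit.
  apply/unitrP; exists (thi (invmx A)); split; apply: th_inj; rewrite rmorphM rmorph1 !thK'.
    by rewrite -mulmxE mulVmx.
  by rewrite -mulmxE mulmxV.
pose g : forall q', Dloc a b Fv q' := @eqtype.dfwith (place F) (fun q' => Dloc a b Fv q') (fun q' => 1) (place_of q) x.
have gq : g q = x by exact: eqtype.dfwith_in.
have gq' (q' : place F) : q' <> place_of q -> g q' = 1.
  by move=> qq; apply: eqtype.dfwith_out; apply/eqP => E; apply: qq; rewrite E.
have gP : is_Dfx OD g.
  split=> [q'||].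
  - by have [->|/gq' ->] := pselect (q' = place_of q); rewrite ?gq ?unitr1.
  - apply: (sub_finite_set _ (finite_set1 (place_of q))) => q' /= nO; apply: contrapT => /gq' E.
    by apply: nO; rewrite E; exact: Oloc1.
  - apply: (sub_finite_set _ (finite_set1 (place_of q))) => q' /= nO; apply: contrapT => /gq' E.
    by apply: nO; rewrite E invr1; exact: Oloc1.
have ex : exists u : Dfx Fv OD, theta q (u q) = A /\ forall q' : place F, q' <> q -> u q' = 1.
  by exists (MkDfx gP); split=> //=; rewrite gq thK'.
exact: (@xgetPex _ 1%g [set u : Dfx Fv OD | theta q (u q) = A /\
  forall q' : place F, q' <> q -> u q' = 1] ex).
Qed.

Variable A : forall q : pplace F p, seq (Fv q).
Hypothesis A_reps : forall q, residue_system (A q).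

Lemma hecke_bounded (f : Dfx Fv OD -> multi -> L) (q : pplace F p) ps : q \notin ps ->
  (forall g, bounded_at v pl wv ps (f g)) ->
  forall g, bounded_at v pl wv (q :: ps) (hecke v sigma_hat wn wv psi theta s pi A q f g).
Proof.
move=> qps fb g m; rewrite /hecke; apply: (vge_sum_seq vP) => alpha alphaA.
have [hq hq'] := hecke_eltP alpha; have [_ AO _ _] := A_reps q.
apply: (weight_act_hecke p_unramified vP vp sigma_ext wn s_ge1 psi_char (pi_unif q) (AO _ alphaA)) => //.
move=> q1 qq1; rewrite /at_p hq' ?rmorph1 //.
by move=> E; case/eqP: qq1; apply/val_inj.
Qed.

Lemma Up_bounded (f : Dfx Fv OD -> multi -> L) ps : uniq ps -> (forall g m, vge v 0 (f g m)) ->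
  forall g, bounded_at v pl wv ps (Up v sigma_hat wn wv psi theta s pi A ps f g).
Proof.
elim: ps => [_ f0 g m|q ps IH /= /andP[qps ups] f0]; first by rewrite big_pred0.
by apply: hecke_bounded => //; exact: IH.
Qed.

Variables (ps : seq (pplace F p)) (idx : pplace F p -> 'I_2).
Hypotheses (ps_uniq : uniq ps) (ps_all : forall q, q \in ps).

(** The valuations w_i gained from the determinants are those removed by the
    normalising factor. *)
Lemma Up0_bounded (f : Dfx Fv OD -> multi -> L) : (forall g m, vge v 0 (f g m)) ->
  forall g (m : multi), vge v (\sum_i (m i)%:R)
    (Up0 v sigma_hat wn wv psi theta s pi A ps idx f g m).
Proof.
move=> f0 g m; rewrite /Up0.
have -> : \sum_i (m i)%:R = \sum_(q <- ps) (- v_weight pl wv q)%:~R +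
    \sum_(i | pl i \in ps) ((wv i)%:~R + (m i)%:R) :> R.
  rewrite [X in _ = _ + X](eq_bigl xpredT) => [|i]; last by rewrite ps_all.
  rewrite big_split addrA /= -[LHS]add0r; congr (_ + _).
  have -> : \sum_(q <- ps) (- v_weight pl wv q)%:~R =
      - \sum_(q <- ps) \sum_i (if pl i == q then (wv i)%:~R else 0) :> R.
    rewrite -sumrN; apply: eq_bigr => q _; rewrite mulrNz /v_weight; congr (- _).
    by rewrite rmorph_sum big_mkcond.
  rewrite exchange_big /= addrC; apply/eqP; rewrite eq_sym subr_eq0; apply/eqP.
  apply: eq_bigr => i _; rewrite (bigD1_seq (pl i)) //= eqxx.
  by rewrite big1_seq ?addr0 // => q /andP[qi _]; rewrite eq_sym (negbTE qi).
apply: (vgeM vP); last exact: Up_bounded.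
apply: (vge_prod vP) => q _.
have piL : v (pi_in_L sigma_hat pi idx q) = 1%:E.
  by rewrite (val_sigma_hat p_unramified vP vp sigma_ext) pi_unif.
by rewrite /vge (valXz vP _ piL) mulr1.
Qed.

Lemma matrix_ex : exists M, is_matrix t S (Up0 v sigma_hat wn wv psi theta s pi A ps idx) M.
Proof.
exists (fun x y => Up0 v sigma_hat wn wv psi theta s pi A ps idx
  (basis_form y.1 y.2) (t x.1) x.2) => j l.
exists (basis_form j l); split=> //; first exact: basis_form_S.
exact: basis_form_t.
Qed.

Lemma matrix_bounded M :
  is_matrix t S (Up0 v sigma_hat wn wv psi theta s pi A ps idx) M ->
  forall x y : 'I_h' * multi, vge v (\sum_i (x.2 i)%:R) (M x y).
Proof.
move=> MP [i m] [j l]; have [f [fS ft ->]] := MP j l.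
apply: Up0_bounded; apply: overconvergent_int => // i' m'; rewrite ft.
by case: eqP => _; [exact: (vge1 vP) | exact: (vge0 vP)].
Qed.

End Forms.

(** * Fredholm series of matrices with small rows *)

Section Fredholm.
Variables (R : realType) (L : fieldType) (v : L -> \bar R).
Hypotheses (vP : is_valuation v) (cL : is_complete v).
Variables (I : choiceType) (M : I -> I -> L) (deg : I -> nat).
Hypothesis M_deg : forall i j, vge v (deg i)%:R (M i j).

Definition pgrowth (rho tau : R) (P : {poly L}) : Prop := growth v rho tau (fun k => P`_k).

Lemma pgrowthM rho tau tau' P Q : pgrowth rho tau P -> pgrowth rho tau' Q ->
  pgrowth rho (tau + tau') (P * Q).
Proof. by move=> hP hQ k; rewrite coefM; exact: (growth_mul vP hP hQ). Qed.

Lemma pgrowth1 rho : pgrowth rho 0 1.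
Proof. by move=> k; rewrite coef1; exact: (growth_one vP). Qed.

Lemma pgrowth_sum rho tau J (r : seq J) (P : pred J) (F : J -> {poly L}) :
  (forall j, P j -> pgrowth rho tau (F j)) -> pgrowth rho tau (\sum_(j <- r | P j) F j).
Proof.
by move=> hF k; rewrite coef_sum; apply: (vge_sum vP) => j Pj; exact: hF.
Qed.

Lemma pgrowth_prod rho J (r : seq J) (tau : J -> R) (F : J -> {poly L}) :
  (forall j, pgrowth rho (tau j) (F j)) ->
  pgrowth rho (\sum_(j <- r) tau j) (\prod_(j <- r) F j).
Proof.
by move=> hF; elim/big_ind2: _ => // [|? ? ? ? ? ?]; [exact: pgrowth1 | exact: pgrowthM].
Qed.

(** Every term of the Leibniz formula has one factor in each row. *)
Lemma pgrowth_det rho N (tau : 'I_N -> R) (A : 'M[{poly L}]_N) :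
  (forall i j, pgrowth rho (tau i) (A i j)) -> pgrowth rho (\sum_i tau i) (\det A).
Proof.
move=> hA; apply: pgrowth_sum => s _ k; rewrite mulr_sign.
have h : pgrowth rho (\sum_i tau i) (\prod_i A i (s i)) by exact: pgrowth_prod.
by case: (odd_perm s); rewrite ?coefN; [apply/(vgeN vP)|]; exact: h.
Qed.

Definition char_mx N (f : 'I_N -> I) : 'M[{poly L}]_N :=
  \matrix_(i, j) ((i == j)%:R - 'X * (M (f i) (f j))%:P).

(** The determinant of 1 - X M on the indices in a sequence. Sequences, unlike
    finite sets, allow an expansion along their first index. *)
Definition char_det (s : seq I) : {poly L} := \det (char_mx (tnth (in_tuple s))).

Lemma char_det_tuple N (T : N.-tuple I) : \det (char_mx (tnth T)) = char_det T.
Proof.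
case: T => s sN; have E := eqP sN; subst N; rewrite /char_det.
by congr (\det (char_mx _)); apply/funext => i; congr tnth; apply/val_inj.
Qed.

Lemma char_det_perm s s' : perm_eq s s' -> char_det s = char_det s'.
Proof.
move=> ss'; have /tuple_permP[p E] : perm_eq s (in_tuple s') by [].
rewrite E -char_det_tuple; set T := mktuple _.
have -> : char_mx (tnth T) = row_perm p (col_perm p (char_mx (tnth (in_tuple s')))).
  by apply/matrixP => i j; rewrite !mxE !tnth_mktuple (inj_eq perm_inj).
rewrite row_permE col_permE !det_mulmx !det_perm odd_permV mulrCA.
by rewrite -expr2 sqrr_sign mulr1.
Qed.

Lemma fredholm_truncE (K : {fset I}) : fredholm_trunc M K = char_det K.
Proof.
pose T := [tuple fsval (enum_val i) | i < #|{: K}|].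
have <- : char_det T = char_det K.
  apply/char_det_perm/uniq_perm; rewrite ?fset_uniq //.
    rewrite map_inj_uniq ?enum_uniq // => i j /val_inj; exact: enum_val_inj.
  move=> x; apply/mapP/idP => [[i _ ->]|xK]; first exact: fsvalP.
  by exists (enum_rank [` xK]%fset); rewrite ?mem_enum // enum_rankK.
rewrite -char_det_tuple; congr (\det _); apply/matrixP => i j.
by rewrite !mxE !tnth_mktuple.
Qed.

(** The constant coefficient is 0 or 1 and that of X has valuation at least the
    degree, so both lie above the line of slope [rho] through
    [(0, deg - rho)], and through the origin if [deg] exceeds [rho]. *)
Lemma char_mx_growth (rho : nat) N (f : 'I_N -> I) i j :
  pgrowth rho%:R (rho - deg (f i))%:R (char_mx f i j).
Proof.
move=> k; rewrite !mxE coefB coefXM coefC.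
case: k => [|[|k]] /=.
- rewrite mul0r sub0r subr0; case: (i == j); last by rewrite coef0; exact: (vge0 vP).
  by rewrite coef1; apply: vgeW (vge1 vP); rewrite oppr_le0.
- rewrite mul1r; case: (i == j); rewrite ?coef1 ?coef0 sub0r; apply/(vgeN vP);
  by apply: vgeW (M_deg _ _); rewrite lerBlDr -natrD ler_nat; lia.
- by case: (i == j); rewrite ?coef1 ?coef0 subr0; exact: (vge0 vP).
Qed.

Lemma char_det_growth (rho : nat) s :
  pgrowth rho%:R (\sum_(x <- s) (rho - deg x)%:R) (char_det s).
Proof.
have -> : \sum_(x <- s) (rho - deg x)%:R =
    \sum_i (rho - deg (tnth (in_tuple s) i))%:R :> R.
  by rewrite (big_tnth _ _ s).
by apply: pgrowth_det => i j; exact: char_mx_growth.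
Qed.

(** In the expansion along the first row, the difference consists of the terms
    that contain an entry of M of that row. *)
Lemma char_det_cons x s : pgrowth 0 (- (deg x)%:R) (char_det (x :: s) - char_det s).
Proof.
rewrite /char_det (expand_det_row _ ord0) (bigD1 ord0) //.
set A := char_mx (tnth (in_tuple (x :: s))).
have cof00 : cofactor A ord0 ord0 = \det (char_mx (tnth (in_tuple s))).
  rewrite /cofactor expr0 mul1r; congr (\det _); apply/matrixP => i j.
  rewrite !mxE; congr (_ - 'X * (M _ _)%:P).
  - by rewrite !(tnth_nth x).
  - by rewrite !(tnth_nth x).
have cof j : pgrowth 0 0 (cofactor A ord0 j).
  have h : pgrowth 0 0 (\det (row' ord0 (col' j A))).
    have := @pgrowth_det 0 _ (fun => 0) (row' ord0 (col' j A)); rewrite big1 //; apply.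
    by move=> i k; rewrite !mxE; have := @char_mx_growth 0 _ (tnth (in_tuple (x :: s)));
      move=> /(_ (lift ord0 i) (lift j k)); rewrite mxE.
  move=> k; rewrite /cofactor -signr_odd mulr_sign; case: (odd _); last exact: h.
  by rewrite coefN; apply/(vgeN vP); exact: h.
have ent j : pgrowth 0 (- (deg x)%:R) ('X * (M x (tnth (in_tuple (x :: s)) j))%:P).
  move=> k; rewrite coefXM coefC mulr0 sub0r opprK.
  by case: k => [|[|k]] /=; rewrite ?M_deg //; exact: (vge0 vP).
have -> : A ord0 ord0 * cofactor A ord0 ord0 + \sum_(i < (size s).+1 | i != ord0)
   A ord0 i * cofactor A ord0 i - \det (char_mx (tnth (in_tuple s))) =
   - \sum_i 'X * (M x (tnth (in_tuple (x :: s)) i))%:P * cofactor A ord0 i.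
  rewrite [in RHS](bigD1 ord0) // -cof00.
  have -> : \sum_(i < (size s).+1 | i != ord0) A ord0 i * cofactor A ord0 i =
      - \sum_(i < (size s).+1 | i != ord0)
          'X * (M x (tnth (in_tuple (x :: s)) i))%:P * cofactor A ord0 i.
    rewrite -sumrN; apply: eq_bigr => i i0.
    by rewrite mxE eq_sym (negbTE i0) sub0r mulNr !(tnth_nth x).
  have -> : A ord0 ord0 = 1 - 'X * (M x (tnth (in_tuple (x :: s)) ord0))%:P.
    by rewrite mxE eqxx !(tnth_nth x).
  rewrite /=; ring.
move=> k; rewrite coefN; apply/(vgeN vP); move: k.
apply: pgrowth_sum => j _; rewrite -[- _]addr0; exact: pgrowthM.
Qed.

Lemma char_det_cat (A : nat) s s' : (forall x, x \in s -> (A <= deg x)%N) ->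
  pgrowth 0 (- A%:R) (char_det (s ++ s') - char_det s').
Proof.
elim: s => [_ k|x s IH sA k] /=; first by rewrite subrr coef0; exact: (vge0 vP).
have -> : char_det (x :: s ++ s') - char_det s' = (char_det (x :: s ++ s') - char_det (s ++ s'))
    + (char_det (s ++ s') - char_det s') by rewrite addrA subrK.
rewrite coefD; apply: (vgeD vP).
  by apply: vgeW (char_det_cons x (s ++ s') k); rewrite !opprK lerD2l ler_nat; apply: sA; rewrite mem_head.
by apply: IH => y ys; apply: sA; rewrite inE ys orbT.
Qed.

Hypothesis deg_proper : forall N : nat, exists K : {fset I}, forall i, i \notin K -> (N <= deg i)%N.

(** Enlarging a finite set that contains all the rows of degree at most A changes
    the coefficients by elements of valuation at least A. *)
Lemma fredholm_ex : exists c, is_fredholm v M c.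
Proof.
suff /choice[c cP] : forall k, exists l, fset_lim v (fun K => (fredholm_trunc M K)`_k) l.
  by exists c.
move=> k; apply: (fset_lim_cauchy vP cL) => A.
have [K0 hK0] := deg_proper (Num.truncn A).+1.
exists K0 => K K0K; rewrite !fredholm_truncE -coefB.
(* The indices outside K0 come first, so that they can be removed one by one. *)
pose s := [seq x <- K | x \notin K0].
have Kperm : perm_eq K (s ++ K0).
  have : perm_eq ([seq x <- K | x \notin K0] ++ [seq x <- K | predC (fun x => x \notin K0) x]) K.
    exact: permEl (perm_filterC _ _).
  rewrite perm_sym => /perm_trans; apply; rewrite perm_cat2l.
  apply: uniq_perm; rewrite ?filter_uniq ?fset_uniq // => x.
  by rewrite mem_filter /= negbK; apply/andb_idr; exact: (fsubsetP K0K).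
rewrite (char_det_perm Kperm).
have sA x : x \in s -> ((Num.truncn A).+1 <= deg x)%N.
  by rewrite mem_filter => /andP[xK0 _]; exact: hK0.
have := char_det_cat K0 sA k; rewrite mulr0 sub0r opprK; apply: vgeW.
exact/ltW/truncnS_gt.
Qed.

Lemma fredholm_ge c (rho : nat) (C : R) k : is_fredholm v M c ->
  (forall K : {fset I}, \sum_(x <- K) (rho - deg x)%:R <= C) ->
  vge v (k%:R * rho%:R - C) (c k).
Proof.
move=> Mc hC; apply: (fset_lim_ge vP (Mc k)) => K; rewrite fredholm_truncE.
by apply: vgeW (char_det_growth rho K k); rewrite lerD2l lerN2.
Qed.

End Fredholm.

(** * The Hodge polygon *)

Lemma sum_subn N M : (N <= M)%N -> ((\sum_(b < M) (N - b)) * 2 = N * N.+1)%N.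
Proof.
elim: N M => [M _|N IH [|M] // NM]; first by rewrite big1.
by rewrite big_ord_recl /= subn0 mulnDl (IH M) //; lia.
Qed.

(** The sum of the N - d with multiplicity d + 1. *)
Lemma sum_subn2 N : ((\sum_(a < N) \sum_(b < N) (N - (a + b))) * 6 = N * N.+1 * N.+2)%N.
Proof.
have -> : (\sum_(a < N) \sum_(b < N) (N - (a + b)) = \sum_(a < N) \sum_(b < N) (N - a - b))%N.
  by apply: eq_bigr => a _; apply: eq_bigr => b _; rewrite subnDA.
rewrite (_ : 6 = 2 * 3)%N // mulnA big_distrl /=.
under eq_bigr do rewrite sum_subn ?leq_subr //.
elim: N => [|N IH]; first by rewrite big_ord0.
by rewrite big_ord_recl /= mulnDl subn0 (eq_bigr (fun a : 'I_N => (N - a) * (N - a).+1)%N) // IH; lia.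
Qed.

Section Monomials.
Variable h : nat.
Implicit Types e : 'I_h * multi.

Definition mdeg e : nat := \sum_i e.2 i.

Lemma mdegE e : mdeg e = (e.2 ord0 + e.2 ord_max)%N.
Proof. by rewrite /mdeg big_ord_recl big_ord1 lift2. Qed.

Definition mono_of N (x : 'I_h * ('I_N * 'I_N)) : 'I_h * multi :=
  (x.1, [ffun k => if k == ord0 then val x.2.1 else val x.2.2]).

Lemma mono_of_inj N : injective (@mono_of N).
Proof.
move=> [i [a b]] [j [a' b']] [-> /ffunP E].
have := E ord0; have := E ord_max; rewrite !ffunE /= => /val_inj -> /val_inj -> //.
Qed.

Definition mono_box N : {fset 'I_h * multi} :=
  [fset mono_of x | x in {: 'I_h * ('I_N * 'I_N)}]%fset.

Lemma mono_boxP N e : e \notin mono_box N -> (N <= mdeg e)%N.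
Proof.
apply: contraNT; rewrite -ltnNge mdegE => eN; case: e eN => j m /= mN.
have m0 : (m ord0 < N)%N by lia.
have m1 : (m ord_max < N)%N by lia.
apply/imfsetP; exists (j, (Ordinal m0, Ordinal m1)) => //.
congr (_, _); apply/ffunP => k; rewrite ffunE /=.
by case: eqP => [->//|]; case: (unliftP ord0 k) => [k' ->|->//]; rewrite (ord1 k') lift2.
Qed.

Lemma sum_mdeg N (K : {fset 'I_h * multi}) :
  ((\sum_(e <- K) (N - mdeg e)) * 6 <= h * (N * N.+1 * N.+2))%N.
Proof.
have -> : (\sum_(e <- K) (N - mdeg e) = \sum_(e <- K | e \in mono_box N) (N - mdeg e))%N.
  rewrite [RHS]big_mkcond; apply: eq_bigr => e _; case: ifPn => // /mono_boxP.
  by rewrite -subn_eq0 => /eqP.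
have : (\sum_(e <- K | e \in mono_box N) (N - mdeg e) <= \sum_(e <- mono_box N) (N - mdeg e))%N.
  rewrite big_fset_condE /= [leqRHS](big_fsetID _ (mem K)) /=.
  have -> : [fset i in K | i \in mono_box N]%fset = [fset x in mono_box N | x \in K]%fset.
    by apply/fsetP => e; rewrite !inE /= andbC.
  exact: leq_addr.
move=> le; apply: (leq_trans (n := ((\sum_(e <- mono_box N) (N - mdeg e)) * 6)%N)).
  by rewrite leq_mul2r le orbT.
rewrite big_imfset /=; last by move=> x y _ _; exact: mono_of_inj.
rewrite big_enum /=.
rewrite -(pair_big xpredT xpredT (fun j x => N - mdeg (mono_of (j, x)))%N) /=.
under eq_bigr => j _.
  rewrite -(pair_big xpredT xpredT (fun a b => N - mdeg (mono_of (j, (a, b))))%N) /=.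
  under eq_bigr => a _ do under eq_bigr => b _ do rewrite mdegE /= !ffunE /=.
  over.
by rewrite sum_nat_const card_ord -mulnA sum_subn2.
Qed.

End Monomials.

Section Polygon.
Variables (R : realType) (L : fieldType) (v : L -> \bar R).
Hypothesis vP : is_valuation v.

(** The hypothesis says that all points (k, v(c_k)) lie above every line carrying
    an edge of the polygon; then so does their convex hull. *)
Lemma newton_polygon_ge (h : nat) (c : nat -> L) :
  (forall i k : nat, vge v (k%:R * i%:R - h%:R * (i%:R * (i%:R + 1) * (i%:R + 2) / 6)) (c k)) ->
  forall x y : R, polygon (bound_vertex R h) (x, y) -> (y%:E <= newton_polygon v c x)%E.
Proof.
move=> hc x y [i [t [t0 t1 /= xE yE]]].
pose C : R := h%:R * (i%:R * (i%:R + 1) * (i%:R + 2) / 6).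
have -> : y = i%:R * x - C.
  by rewrite xE yE /C -!natr1; field.
apply: le_ereal_inf_tmp => _ [z [N [m [lam [lam0 lam1 c0 /= xE' ->]]]] <-].
have CE : C = \sum_k lam k * C by rewrite -mulr_suml lam1 mul1r.
rewrite lee_fin xE' [X in _ - X]CE mulr_sumr -sumrB; apply: ler_sum => k _.
have := hc i (m k); have [e E] := val_real vP (c0 k); rewrite /vge E lee_fin /= => le.
have -> : i%:R * (lam k * (m k)%:R) - lam k * C = lam k * ((m k)%:R * i%:R - C) by ring.
exact: ler_wpM2l.
Qed.

End Polygon.

Theorem mainTheorem1 (R : realType)
  (* the real quadratic field F, its completions, and the unramified prime p *)
  (F : fieldExtType rat) (F_quadratic : real_quadratic F R)
  (Fv : forall q : place F, completion R q)
  (p : nat) (p_prime : prime p) (p_unramified : unramified Fv p)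
  (pi : forall q : pplace F p, Fv q) (pi_unif : forall q, cval (pi q) = 1%:E)
  (* the quaternion algebra D = (a, b / F), a maximal order and splittings *)
  (a b : F) (a_neq0 : a != 0) (b_neq0 : b != 0)
  (D_definite : totally_definite a b R)
  (D_unramified : forall q : place F, unramified_at a b Fv q)
  (OD : max_order a b)
  (* the level U = U_0(n p^s) *)
  (n : set F) (n_ideal : is_ideal n) (n_prime_to_p : prime_to n p)
  (s : nat) (s_ge1 : (1 <= s)%N)
  (theta : forall q : place F, {rmorphism Dloc a b Fv q -> 'M[Fv q]_2})
  (theta_split : forall q : place F, divides q [set p%:R * x | x in n] ->
     is_splitting OD (theta q))
  (U : set (Dfx Fv OD)) (U_def : U = U0 theta n p s)
  (h' : nat) (t : 'I_h' -> Dfx Fv OD) (t_reps : double_coset_reps U t)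
  (U_small : sufficiently_small U t)
  (* the complete field L inside C_p, and the embeddings of F *)
  (C : padic_complex R p) (L : fieldType) (iota : {rmorphism L -> C})
  (v : L -> \bar R) (v_def : forall x, v x = Cp_val (iota x))
  (L_complete : is_complete v)
  (sigma : 'I_2 -> {rmorphism F -> L})
  (sigma_distinct : exists x, sigma ord0 x <> sigma ord_max x)
  (pl : 'I_2 -> pplace F p)
  (sigma_hat : forall i, {rmorphism Fv (pl i) -> L})
  (sigma_ext : forall i, is_extension v (sigma i) (sigma_hat i))
  (* the locally algebraic weight *)
  (wn wv : 'I_2 -> int) (r : int) (weight : forall i, wn i + 2 * wv i = r)
  (psi : Fp p Fv -> L) (psi_char : is_character s psi)
  (psi_units : forall x, unitOfInt x ->
     psi (Fp_diag Fv x) = (\prod_i sigma i x) ^ r)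
  (* the auxiliary choices in the definition of U_p^0 *)
  (A : forall q : pplace F p, seq (Fv q)) (A_reps : forall q, residue_system (A q))
  (ps : seq (pplace F p)) (ps_uniq : uniq ps) (ps_all : forall q, q \in ps)
  (idx : pplace F p -> 'I_2) (idxK : cancel idx pl)
  (h : nat) (h_dim : has_dim (S2 (L := L) U) h) :
  let S := overconvergent v sigma_hat wn wv psi theta U in
  let V := Up0 v sigma_hat wn wv psi theta s pi A ps idx in
  (exists c, is_fredholm_series v t S V c) /\
  (forall c, is_fredholm_series v t S V c ->
   forall x y : R, polygon (bound_vertex R h) (x, y) ->
     (y%:E <= newton_polygon v c x)%E).
Proof.
move=> S V.
have [F2 _] := F_quadratic.
have vP : is_valuation v.
  have [CP0 CPNy CPM CPD] := Cp_valuation C; split=> [x|x|x y|x y]; rewrite !v_def.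
  - rewrite CP0; split=> [/eqP|->]; last exact: rmorph0.
    by rewrite fmorph_eq0 => /eqP.
  - exact: CPNy.
  - by rewrite rmorphM CPM.
  - by rewrite rmorphD CPD.
have vp : v p%:R = 1%:E by rewrite v_def rmorph_nat Cp_val_p.
subst U; have hh := dim_S2 theta_split t_reps h_dim; subst h.
have MS M : is_matrix t S V M -> forall x y, vge v (mdeg x)%:R (M x y).
  move=> MP x y; rewrite /mdeg natr_sum.
  exact: (matrix_bounded p_unramified n_ideal s_ge1 theta_split t_reps vP vp sigma_ext
    psi_char pi_unif A_reps ps_uniq ps_all MP).
split.
  have [M MP] := matrix_ex p_unramified F2 n_ideal s_ge1 theta_split t_reps U_small vP
    L_complete vp sigma_ext sigma_distinct weight psi_char psi_units pi A ps idx.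
  have [c Mc] := fredholm_ex vP L_complete (MS M MP)
    (fun N => ex_intro _ (mono_box h' N) (@mono_boxP h' N)).
  by exists c, M.
move=> c [M MP Mc]; apply: (newton_polygon_ge vP) => i k.
apply: (fredholm_ge vP (MS M MP) k Mc) => K.
rewrite -natr_sum -!(natrD _ _ 1) -(natrD _ _ 2) -!natrM mulrA -natrM.
rewrite ler_pdivlMr // -natrM ler_nat addn1 addn2.
exact: sum_mdeg.
Qed.
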